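(* If $\lambda(\rho)\in(0,\infty)$, then for any integer $k\ge1$ $$\lim_{n\to\infty}E_{\Phi^n(\nu_\rho)}[\tau^k]=\frac{k!}{\lambda(\rho)^k}.$$ Moreover, for any $s\ge0$, $$\lim_{n\to\infty}P_{\Phi^n(\nu_\rho)}(\tau>s)=\exp(-\lambda(\rho)s).$$
   Context: Setting (''processus des misanthropes'' on $\mathbb Z^d$). Here $\mathbb N=\{0,1,2,\dots\}$ and $\mathbb N^{\mathbb Z^d}$ has the product topology. The rates $\{p(i,j)\}_{i,j\in\mathbb Z^d}$ satisfy: (i) $p(i,j)\ge 0$ and $\sum_i p(0,i)=1$; (ii) $p(i,j)=p(0,j-i)$; (iii) $p(i,j)=0$ if $|i-j|>R$, for some fixed $R$; (iv) with $p_s(i,j)=p(i,j)+p(j,i)$, for every $i\in\mathbb Z^d$ there is $n$ with $p_s^{(n)}(0,i)>0$; (v) $\sum_i i\,p(0,i)\ne 0$. The function $b:\mathbb N\times\mathbb N\to[0,\infty)$ satisfies: $b(0,\cdot)\equiv 0$; $n\mapsto b(n,m)$ is nondecreasing for each $m$; $m\mapsto b(n,m)$ is nonincreasing for each $n$; $b(n,m)-b(m,n)=b(n,0)-b(m,0)$ for all $n,m\ge1$; $\Delta:=\sup_n(b(n+1,0)-b(n,0))<\infty$. Moreover it is assumed that there is $g:\mathbb N\to[0,\infty)$ nondecreasing with $g(0)=0$, $g(1)=1$, $\sup_k(g(k+1)-g(k))<\infty$, and $b(n,m-1)g(m)=b(m,n-1)g(n)$ for $n,m\ge 1$. The process $\{\eta_t\}$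 is the Feller process (Andjel's construction) on $\Omega=\{\eta\in\mathbb N^{\mathbb Z^d}:\sum_i e^{-a|i|}\eta(i)<\infty\text{ for some }a>0\}$ whose generator acts on a core of local functions by $$\mathcal L\varphi(\eta)=\sum_{i,j}p(i,j)\,b(\eta(i),\eta(j))\,(\varphi(\eta^i_j)-\varphi(\eta)),$$ where $\eta^i_j$ is obtained from $\eta$ by moving one particle from $i$ to $j$. The choice $b(n,m)=g(n)$ gives the zero range process. The exclusion process is also included: state space $\{0,1\}^{\mathbb Z^d}$, $b(n,m)=1$ if $n=1,m=0$ and $0$ otherwise, with $\nu_\rho$ below the product Bernoulli measure of density $\rho$. Invariant measures. For $\gamma\in[0,\sup_k g(k))$ let $\theta_\gamma$ be the probability on $\mathbb N$ with $\theta_\gamma(0)=1/Z(\gamma)$ and $\theta_\gamma(n)=\frac1{Z(\gamma)}\frac{\gamma^n}{g(1)\cdots g(n)}$ for $n\ge1$, $Z(\gamma)$ being the normalization. Let $\Upsilon(\gamma)=\sum_{n\ge 1}n\theta_\gamma(n)$ (increasing), let $\gamma(\cdot)$ be the inverse function of $\Upsilon$, and for $0<\rho<\sup_\gamma\Upsilon(\gamma)$ let $\nu_\rho$ be the product measure on $\mathbb N^{\mathbb Z^d}$ with all marginals $\theta_{\gamma(\rho)}$; it is invariant for $\mathcal L$. Conditioning. Fix a finite $\Lambda\subset\mathbb Z^d$ and an integer $k_0$, and set $\mathcal A=\{\eta:\sum_{i\in\Lambda}\eta(i)>k_0\}$. The density $\rho$ is always such that $\nu_\rho(\mathcal A^c)>0$.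 Let $\tau=\inf\{t\ge0:\eta_t\in\mathcal A\}$; $P_\mu,E_\mu$ denote law and expectation of the process with initial law $\mu$, and $T_t(\mu)$ is the law of $\eta_t$ conditioned on $\{\tau>t\}$ under $P_\mu$. The limit $\lambda(\rho):=-\lim_{t\to\infty}\frac1t\log P_{\nu_\rho}(\tau>t)\in[0,\infty)$ exists. For a probability $\mu$ with $0<E_\mu[\tau]<\infty$, $\Phi(\mu)$ is the probability $$\Phi(\mu)=\frac1{E_\mu[\tau]}\int_0^\infty T_t(\mu)\,P_\mu(\tau>t)\,dt,\quad\text{i.e.}\quad \int\varphi\,d\Phi(\mu)=\frac1{E_\mu[\tau]}\int_0^\infty E_\mu[\varphi(\eta_t)1_{\{\tau>t\}}]\,dt,$$ and $\Phi^n$ is the $n$-th iterate of $\Phi$ (all iterates $\Phi^n(\nu_\rho)$ are well defined when $\lambda(\rho)>0$). *)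

(* Defs.v *)
From HB Require Import structures.
From mathcomp Require Import all_boot all_order all_algebra finmap.
From mathcomp Require Import all_classical all_reals all_analysis.

Set Implicit Arguments.
Unset Strict Implicit.
Unset Printing Implicit Defensive.

Import Order.TTheory GRing.Theory Num.Theory.
Import numFieldNormedType.Exports.

Local Open Scope classical_set_scope.
Local Open Scope ring_scope.

Definition site (d : nat) := 'rV[int]_d.

(* All norms on Z^d are interchangeable here: the norm only enters through
   "finite range" and through "summable against exp (- a |i|) for some a". *)
Definition site_norm (d : nat) (i : site d) : nat := \max_(k < d) `|i ord0 k|%N.

Definition config_fun (d : nat) := site d -> nat.

Definition cylinders (d : nat) : set (set (config_fun d)) :=
  [set C | exists i (B : set nat), C = [set eta | B (eta i)]].

(* N^(Z^d) with its product sigma-algebra, which is also the Borel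
   sigma-algebra of the product topology. *)
Definition config (d : nat) := g_sigma_algebraType (@cylinders d).

Section Rates.
Context {R : realType} {d : nat}.
Implicit Type p : site d -> site d -> R.

Definition sym_rate p (i j : site d) : R := p i j + p j i.

(* n-th matrix power of sym_rate p *)
Fixpoint sym_rate_iter p (n : nat) (i j : site d) : \bar R :=
  if n is m.+1 then
    (\esum_(k in setT) (sym_rate_iter p m i k * (sym_rate p k j)%:E))%E
  else ((i == j)%:R)%:E.

Definition drift p : 'rV[R]_d :=
  \sum_(i \in [set: site d]) p 0 i *: map_mx (fun z : int => z%:~R) i.

Record jump_rates p : Prop := JumpRates {
  jump_ge0 : forall i j, 0 <= p i j ;
  jump_sum1 : (\esum_(i in [set: site d]) (p 0 i)%:E = 1)%E ;
  jump_translation : forall i j : site d, p i j = p 0 (j - i) ;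
  jump_finite_range : exists r : nat,
    forall i j : site d, (r < site_norm (i - j)%R)%N -> p i j = 0 ;
  jump_irreducible : forall i : site d, exists n, (0 < sym_rate_iter p n 0%R i)%E ;
  jump_drift : drift p != 0 }.

End Rates.

Record misanthrope_rate (R : realType) (b : nat -> nat -> R) (g : nat -> R) :
    Prop := MisanthropeRate {
  mis_b_ge0 : forall n m, 0 <= b n m ;
  mis_b0 : forall m, b 0%N m = 0 ;
  mis_b_nondecreasing : forall m, {homo b^~ m : n n' / (n <= n')%N >-> n <= n'} ;
  mis_b_nonincreasing : forall n, {homo b n : m m' / (m <= m')%N >-> m' <= m} ;
  mis_b_antisym : forall n m, (1 <= n)%N -> (1 <= m)%N ->
    b n m - b m n = b n 0%N - b m 0%N ;
  mis_b_increments : has_ubound (range (fun n => b n.+1 0%N - b n 0%N)) ;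
  mis_g_ge0 : forall n, 0 <= g n ;
  mis_g_nondecreasing : {homo g : n n' / (n <= n')%N >-> n <= n'} ;
  mis_g0 : g 0%N = 0 ;
  mis_g1 : g 1%N = 1 ;
  mis_g_increments : has_ubound (range (fun k => g k.+1 - g k)) ;
  mis_balance : forall n m, (1 <= n)%N -> (1 <= m)%N ->
    b n m.-1 * g m = b m n.-1 * g n }.

Section ThetaMeasure.
Context {R : realType}.
Implicit Types (g : nat -> R) (gam rho : R).

Definition theta_weight g gam (n : nat) : R :=
  gam ^+ n / \prod_(1 <= k < n.+1) g k.

Definition partition_fun g gam : \bar R :=
  (\sum_(0 <= n <oo) (theta_weight g gam n)%:E)%E.

Definition theta g gam (n : nat) : R :=
  theta_weight g gam n / fine (partition_fun g gam).

Definition fugacities g : set R :=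
  [set gam | 0 <= gam /\ (gam%:E < ereal_sup (range (EFin \o g)))%E].

Definition Upsilon g gam : \bar R :=
  (\sum_(1 <= n <oo) (n%:R * theta g gam n)%:E)%E.

(* the inverse function of Upsilon *)
Definition fugacity g rho : R :=
  get [set gam | fugacities g gam /\ Upsilon g gam = rho%:E].

End ThetaMeasure.

Variant model (R : realType) :=
  | Misanthrope (b : nat -> nat -> R) (g : nat -> R)
  | Exclusion.

Arguments Exclusion {R}.

Section Model.
Context {R : realType}.
Implicit Types (M : model R) (rho : R).

Definition model_wf M : Prop :=
  if M is Misanthrope b g then misanthrope_rate b g else True.

Definition model_rate M : nat -> nat -> R :=
  match M with
  | Misanthrope b _ => b
  | Exclusion => fun n m => ((n == 1%N) && (m == 0%N))%:R
  end.

Definition state_space (d : nat) M : set (config d) :=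
  match M with
  | Misanthrope _ _ => [set eta | exists2 a : R, 0 < a &
      (\esum_(i in [set: site d])
          (expR (- a * (site_norm i)%:R) * (eta i)%:R)%:E < +oo)%E]
  | Exclusion => [set eta | forall i, (eta i <= 1)%N]
  end.

Definition density_range M : set R :=
  match M with
  | Misanthrope _ g => [set rho | 0 < rho /\
      (rho%:E < ereal_sup [set Upsilon g gam | gam in fugacities g])%E]
  | Exclusion => [set rho | 0 < rho < 1]
  end.

Definition marginal M rho (n : nat) : R :=
  match M with
  | Misanthrope _ g => theta g (fugacity g rho) n
  | Exclusion =>
      if n == 1%N then rho else if n == 0%N then 1 - rho else 0
  end.

(* This determines nu: the events below, over all finite D and xi, form a
   pi-system generating the product sigma-algebra. *)
Definition product_law (d : nat) (q : nat -> R) (nu : probability (config d) R) :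
    Prop :=
  forall (D : {fset site d}) (xi : site d -> nat),
    nu [set eta : config d | forall i, i \in D -> eta i = xi i] =
    (\prod_(i <- D) q (xi i))%:E.

End Model.

Section Dynamics.
Context {R : realType} {d : nat}.
Variables (p : site d -> site d -> R) (b : nat -> nat -> R).

Definition move (i j : site d) (eta : config d) : config d :=
  fun k => (eta k - (k == i) + (k == j))%N.

(* The generator with jumps restricted to D. For D = setT and phi local this is
   a finite sum, as p has finite range. *)
Definition generator_on (D : set (site d)) (phi : config d -> R)
    (eta : config d) : R :=
  \sum_(ij \in D `*` D)
    p ij.1 ij.2 * b (eta ij.1) (eta ij.2) * (phi (move ij.1 ij.2 eta) - phi eta).

Definition generator := generator_on setT.

Definition box (n : nat) : set (site d) := [set i | (site_norm i <= n)%N].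

(* The exponential series of the generator in a box; finitely many configurations
   can be reached from eta by jumps within the box, so it converges. *)
Definition box_semigroup (n : nat) (t : R) (phi : config d -> R)
    (eta : config d) : R :=
  limn (series (fun k =>
    t ^+ k / k`!%:R * iter k (generator_on (box n)) phi eta)).

Definition local_fun (phi : config d -> R) : Prop :=
  exists D : {fset site d}, forall eta zeta : config d,
    (forall i, i \in D -> eta i = zeta i) -> phi eta = phi zeta.

Context {dW : measure_display} {W : measurableType dW}.
Variable X : R -> W -> config d.

(* sigma(X_u, u <= s) *)
Definition history (s : R) : set (set W) :=
  <<s [set F | exists (u : R) (B : set (config d)),
         [/\ 0 <= u <= s, measurable B & F = X u @^-1` B]] >>.

Variable P : R.-pker (config d) ~> W.

(* X : cadlag process with law P eta when started from eta (only the values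
   P eta for eta in the state space S are relevant).
   proc_andjel: Andjel's construction, the transition function on local functions
   is the limit of those of the finite systems in growing boxes; this determines
   the law of X under P eta. *)
Record is_process (S : set (config d)) : Prop := IsProcess {
  proc_measurable : forall t : R, 0 <= t -> measurable_fun setT (X t) ;
  proc_right_cont : forall w (t : R) i, 0 <= t ->
    X s w i @[s --> t^'+] --> X t w i ;
  proc_left_lim : forall w (t : R) i, 0 < t -> cvg (X s w i @[s --> t^'-]) ;
  proc_start : forall eta, S eta -> P eta [set w | X 0 w = eta] = 1%E ;
  proc_state : forall eta, S eta ->
    {ae P eta, forall w, forall t : R, 0 <= t -> S (X t w)} ;
  proc_markov : forall eta (s t : R) (F : set W) (B : set (config d)),
    S eta -> 0 <= s -> 0 <= t -> history s F -> measurable B ->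
    P eta (F `&` X (s + t) @^-1` B) =
    (\int[P eta]_(w in F) P (X s w) (X t @^-1` B))%E ;
  proc_andjel : forall eta (t : R) (phi : config d -> R),
    S eta -> 0 <= t -> local_fun phi -> bounded_fun phi ->
    (box_semigroup n t phi eta)%:E @[n --> \oo] -->
      (\int[P eta]_w (phi (X t w))%:E)%E ;
  proc_generator : forall eta (t : R) (phi : config d -> R),
    S eta -> 0 <= t -> local_fun phi -> bounded_fun phi ->
    (\int[P eta]_w (phi (X t w))%:E =
     (phi eta)%:E +
     \int[lebesgue_measure]_(s in `[0%R, t])
        \int[P eta]_w (generator phi (X s w))%:E)%E }.

End Dynamics.

Section HittingTime.
Context {R : realType} {d : nat} {dW : measure_display} {W : measurableType dW}.
Variables (X : R -> W -> config d) (P : R.-pker (config d) ~> W).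
Variable A : set (config d).
Implicit Type mu : probability (config d) R.

(* +oo when A is never hit *)
Definition tau (w : W) : \bar R :=
  ereal_inf [set t%:E | t in [set t : R | 0 <= t /\ A (X t w)]].

Definition Pmu mu (F : set W) : \bar R := (\int[mu]_eta P eta F)%E.

Definition Emu mu (f : W -> \bar R) : \bar R :=
  (\int[mu]_eta \int[P eta]_w f w)%E.

Definition survival mu (t : R) : \bar R := Pmu mu [set w | (t%:E < tau w)%E].

Definition tau_moment mu (k : nat) : \bar R := Emu mu (fun w => (tau w ^+ k)%E).

(* P_mu(eta_t in B, tau > t), that is T_t(mu)(B) P_mu(tau > t) *)
Definition killed_law mu (t : R) (B : set (config d)) : \bar R :=
  Pmu mu [set w | B (X t w) /\ (t%:E < tau w)%E].

Definition Phi_spec mu (mu' : probability (config d) R) : Prop :=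
  (0 < Emu mu tau < +oo)%E /\
  forall B : set (config d), measurable B ->
    mu' B = ((fine (Emu mu tau))^-1%:E *
             \int[lebesgue_measure]_(t in `[0%R, +oo[) killed_law mu t B)%E.

(* Phi mu is the probability mu' such that Phi_spec mu mu'; the default value mu
   is used if there is none. *)
Definition Phi mu : probability (config d) R :=
  xget mu [set mu' | Phi_spec mu mu'].

Definition is_decay_rate mu (l : \bar R) : Prop :=
  (- ((t^-1)%:E * lne (survival mu t)))%E @[t --> +oo%R] --> l.

End HittingTime.

Definition crowded (d : nat) (L : {fset site d}) (k0 : int) : set (config d) :=
  [set eta | k0 < ((\sum_(i <- L) eta i)%N)%:Z].

(* Main.v *)
Require Import Defs.
From HB Require Import structures.
From mathcomp Require Import all_boot all_order all_algebra finmap.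
From mathcomp Require Import all_classical all_reals all_analysis.
From mathcomp Require Import measurable_realfun zify ring lra.
Import Order.TTheory GRing.Theory Num.Theory.
Import numFieldNormedType.Exports.
Local Open Scope classical_set_scope.
Local Open Scope ring_scope.

(* Write u(t) = P_nu(tau > t) and u_n(t) for the survival function of
   Phi^n(nu). The Markov property (extended to the hitting time through dyadic
   grids, by right continuity of the paths) gives
     u_(n+1)(s) = (1 / r_n) int_s^oo u_n,   r_n = int_0^oo u_n = E_(Phi^n nu)[tau],
   so that E_(Phi^n nu)[tau^k] = k! r_n r_(n+1) ... r_(n+k-1), and everything
   reduces to r_n -> 1 / lambda. The products r_0 ... r_(n-1) equal
   E_nu[tau^n] / n!, hence by the decay of u behave like lambda^(-n) up to
   subexponential factors, and by Cauchy-Schwarz the moments int t^n u(t) dt are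
   log-convex, i.e. n r_n is nondecreasing; this forces the ratios r_n to
   converge. The survival functions
   then converge because u |-> 1 - (1 / r_n) int_0^s u is, for r_n close to
   1 / lambda, nearly a contraction with fixed point exp(- lambda s) in the norm
   weighted by exp(- 2 lambda s). *)

(** * Monotone class argument for integrals *)

(** The hypothesis on lambda is only logarithmic, so it controls averages of [ln (r n)], and
    convergence of averages does not give convergence of the terms; monotonicity of [n * r n] is the
    Tauberian condition that closes this gap. It comes from [u 0] alone: its moments are
    [m n = n! * r_0 * ... * r_n], so [m (n+1) / m n = (n+1) * r_(n+1)], and log-convexity says that
    this quotient is nondecreasing. Two obstacles shape the probabilistic half. The Markov property
    is given for events and for starting points in the state space: hence a transfer from events to
    integrals ([posfun_ext]), and the proof that nu and its iterates give no mass to the complement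
    of the state space. Moreover [Phi] is a choice with a default value, so its formula is available
    only where the mean of tau is positive and finite; this is proved for all iterates together with
    two-sided exponential bounds, which survive the iteration because integrating [exp (- kap * s)]
    over a tail keeps the rate and divides by kap. *)

Section PositiveFunctional.
Local Open Scope ereal_scope.
Context {R : realType}.

Definition nnmeasurable {d} {T : measurableType d} (f : T -> \bar R) : Prop :=
  (forall x, 0 <= f x) /\ measurable_fun setT f.

(** The properties through which a functional on nonnegative measurable functions is determined by
    its values on indicators. Iterated integrals against kernels have them as well as plain
    integrals, which makes the two comparable. *)
Record posfun {d} {T : measurableType d} (I : (T -> \bar R) -> \bar R) : Prop :=
  Posfun {
  posfun_ge0 : forall f, nnmeasurable f -> 0 <= I f ;
  posfunD : forall f g, nnmeasurable f -> nnmeasurable g ->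
    I (f \+ g) = I f + I g ;
  posfunZ : forall (c : R) f, (0 <= c)%R -> nnmeasurable f ->
    I (fun x => c%:E * f x) = c%:E * I f ;
  posfun_le : forall f g, nnmeasurable f -> nnmeasurable g ->
    (forall x, f x <= g x) -> I f <= I g ;
  posfun_lim : forall f : (T -> \bar R)^nat, (forall n, nnmeasurable (f n)) ->
    (forall x, nondecreasing_seq (f ^~ x)) ->
    I (fun x => limn (f ^~ x)) = limn (fun n => I (f n)) }.

Lemma nnmeasurable_indic {d} {T : measurableType d} (A : set T) :
  measurable A -> nnmeasurable (fun x => (\1_A x)%:E).
Proof.
by move=> mA; split=> [x|]; [rewrite lee_fin|apply/measurable_EFinP/measurable_indic].
Qed.

Lemma nnmeasurable_comp {d d'} {T : measurableType d} {T' : measurableType d'}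
    (f : T' -> \bar R) (phi : T -> T') :
  measurable_fun setT phi -> nnmeasurable f -> nnmeasurable (f \o phi).
Proof. by move=> mphi [f0 mf]; split=> [x|]; [exact: f0|exact: measurableT_comp]. Qed.

Import HBNNSimple.

Lemma posfun_ext {d} {T : measurableType d} (I J : (T -> \bar R) -> \bar R) :
  posfun I -> posfun J ->
  (forall A, measurable A ->
     I (fun x => (\1_A x)%:E) = J (fun x => (\1_A x)%:E)) ->
  forall f, nnmeasurable f -> I f = J f.
Proof.
move=> pI pJ IJ.
have IJs (g : {nnsfun T >-> R}) : I (EFin \o g) = J (EFin \o g).
  pose term r x := r%:E * (\1_(g @^-1` [set r]) x)%:E : \bar R.
  have mterm r : (0 <= r)%R -> nnmeasurable (term r).
    move=> r0; split=> [x|]; first by rewrite mule_ge0 ?lee_fin.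
    by apply: measurable_funeM; apply/measurable_EFinP/measurable_indic.
  have IJsum (s : seq R) : all (fun r => 0 <= r)%R s ->
      nnmeasurable (fun x => \sum_(r <- s) term r x) /\
      I (fun x => \sum_(r <- s) term r x) = J (fun x => \sum_(r <- s) term r x).
    elim: s => [_|r s IHs /= /andP[r0 s0]].
      (* The empty sum is written as zero times an indicator, so that [posfunZ] yields the value
         zero. *)
      have -> : (fun x => \sum_(r <- [::]) term r x) =
                (fun x : T => 0%:E * (\1_set0 x)%:E).
        by apply/funext => x; rewrite big_nil mul0e.
      have m0 := nnmeasurable_indic _ (@measurable0 _ T).
      split; last by rewrite (posfunZ _ pI)// (posfunZ _ pJ)// !mul0e.
      split=> [x|]; first by rewrite mul0e.
      exact: measurable_funeM m0.2.
    have [ms IJs] := IHs s0.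
    have -> : (fun x => \sum_(r <- r :: s) term r x) =
              term r \+ (fun x => \sum_(r <- s) term r x).
      by apply/funext => x; rewrite big_cons.
    split; first (split=> [x|]).
    - by rewrite adde_ge0 ?(mterm r r0).1 ?ms.1.
    - by apply: emeasurable_funD; [exact: (mterm r r0).2|exact: ms.2].
    rewrite (posfunD _ pI)//; last exact: mterm.
    rewrite (posfunD _ pJ)//; last exact: mterm.
    rewrite IJs; congr (_ + _); rewrite /term.
    have m1 : nnmeasurable (fun x => (\1_(g @^-1` [set r]) x)%:E : \bar R).
      exact: nnmeasurable_indic.
    by rewrite (posfunZ _ pI)// (posfunZ _ pJ)// IJ.
  have -> : EFin \o g = fun x => \sum_(r <- fset_set (range g)) term r x.
    apply/funext => x /=; rewrite fimfunE fsbig_finite//= -sumEFin.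
    by apply: eq_bigr => r _; rewrite EFinM.
  apply: (IJsum _ _).2; apply/allP => r.
  by rewrite in_fset_set// inE => -[x _ <-].
move=> f [f0 mf].
pose g := nnsfun_approx measurableT mf.
have -> : f = fun x => limn (fun n => (EFin \o g n) x).
  apply/funext => x; apply/esym/cvg_lim => //.
  exact: cvg_nnsfun_approx.
have mg n : nnmeasurable (EFin \o g n).
  by split=> [x|]; [rewrite lee_fin|exact/measurable_EFinP].
have ndg x : nondecreasing_seq (fun n => (EFin \o g n) x).
  by move=> m n mn; rewrite lee_fin; exact/lefP/nd_nnsfun_approx.
rewrite (posfun_lim _ pI (fun n => EFin \o g n))//.
rewrite (posfun_lim _ pJ (fun n => EFin \o g n))//.
by congr (limn _); apply/funext => n; exact: IJs.
Qed.

Lemma posfun_integral {d} {T : measurableType d}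
    (mu : {measure set T -> \bar R}) (D : set T) :
  measurable D -> posfun (fun f => \int[mu]_(x in D) f x).
Proof.
move=> mD; split.
- by move=> f [f0 mf]; exact: integral_ge0.
- by move=> f g [f0 mf] [g0 mg]; rewrite ge0_integralD//; exact: measurable_funTS.
- by move=> c f c0 [f0 mf]; rewrite ge0_integralZl_EFin//; exact: measurable_funTS.
- move=> f g [f0 mf] [g0 mg] fg; apply: ge0_le_integral => //;
  exact: measurable_funTS.
- move=> f mf ndf; rewrite monotone_convergence// => n.
  + exact: measurable_funTS (mf n).2.
  + by move=> x _; exact: (mf n).1.
Qed.

Lemma posfun_comp {d d'} {T : measurableType d} {T' : measurableType d'}
    (I : (T -> \bar R) -> \bar R) (phi : T -> T') :
  measurable_fun setT phi -> posfun I -> posfun (fun f => I (f \o phi)).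
Proof.
move=> mphi pI; have mc f := nnmeasurable_comp f _ mphi.
split.
- by move=> f mf; apply: (posfun_ge0 _ pI); exact: mc.
- by move=> f g mf mg; rewrite -(posfunD _ pI)//; exact: mc.
- by move=> c f c0 mf; rewrite -(posfunZ _ pI)//; exact: mc.
- move=> f g mf mg fg; apply: (posfun_le _ pI (f \o phi) (g \o phi)).
  + exact: mc.
  + exact: mc.
  + by move=> x; exact: fg.
- move=> f mf ndf; rewrite -(posfun_lim _ pI (fun n => f n \o phi))//.
  + by move=> n; exact: (mc _ (mf n)).
  + by move=> x; exact: ndf.
Qed.

Lemma posfun_mixture {d d'} {T : measurableType d} {T' : measurableType d'}
    (mu : {measure set T' -> \bar R}) (D : set T')
    (I : T' -> (T -> \bar R) -> \bar R) :
  measurable D -> (forall y, D y -> posfun (I y)) ->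
  (forall f, nnmeasurable f -> measurable_fun D (I ^~ f)) ->
  posfun (fun f => \int[mu]_(y in D) I y f).
Proof.
move=> mD pI mI; split.
- by move=> f mf; apply: integral_ge0 => y Dy; exact: (posfun_ge0 _ (pI y Dy)).
- move=> f g mf mg; rewrite -ge0_integralD//; last 4 first.
  + by move=> y Dy; exact: (posfun_ge0 _ (pI y Dy)).
  + exact: mI.
  + by move=> y Dy; exact: (posfun_ge0 _ (pI y Dy)).
  + exact: mI.
  by apply: eq_integral => y /[!inE] Dy; rewrite (posfunD _ (pI y Dy)).
- move=> c f c0 mf; rewrite -ge0_integralZl_EFin//; last 2 first.
  + by move=> y Dy; exact: (posfun_ge0 _ (pI y Dy)).
  + exact: mI.
  by apply: eq_integral => y /[!inE] Dy; rewrite (posfunZ _ (pI y Dy)).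
- move=> f g mf mg fg; apply: ge0_le_integral => //.
  + by move=> y Dy; exact: (posfun_ge0 _ (pI y Dy)).
  + exact: mI.
  + exact: mI.
  + by move=> y Dy; exact: (posfun_le _ (pI y Dy)).
- move=> f mf ndf; rewrite -monotone_convergence//.
  + by apply: eq_integral => y /[!inE] Dy; rewrite (posfun_lim _ (pI y Dy)).
  + by move=> n; exact: mI.
  + by move=> n y Dy; exact: (posfun_ge0 _ (pI y Dy)).
  + by move=> y Dy m n mn; apply: (posfun_le _ (pI y Dy)) => // x; exact: ndf.
Qed.

End PositiveFunctional.

(** * Layer cake formula *)

Section LayerCake.
Context {R : realType}.
Local Notation leb := (@lebesgue_measure R).

Lemma integral_itv0c_deriv (F f : R -> R) (b : R) : 0 <= b ->
  (forall x : R, is_derive x (1 : R) F (f x)) -> continuous f ->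
  (\int[leb]_(x in `[0%R, b]) (f x)%:E = (F b - F 0)%:E)%E.
Proof.
rewrite le_eqVlt => /predU1P[<-|b0] dF cf.
  by rewrite set_itv1 integral_set1 subrr.
have cF : continuous F.
  move=> x; apply/differentiable_continuous/derivable1_diffP.
  exact: (@ex_derive _ _ _ _ _ _ _ (dF x)).
rewrite (@continuous_FTC2 _ f F 0 b b0)//.
- exact: continuous_subspaceT.
- split.
  + by move=> x _; exact: (@ex_derive _ _ _ _ _ _ _ (dF x)).
  + exact/cvg_at_right_filter/cF.
  + exact/cvg_at_left_filter/cF.
- by move=> x _; rewrite derive1E; exact: (@derive_val _ _ _ _ _ _ _ (dF x)).
Qed.

Lemma measurable_natmul_exp (k : nat) :
  measurable_fun [set: R] (fun s : R => (k.+1%:R * s ^+ k)).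
Proof.
by apply: measurable_funM => //; apply/measurable_funX/measurable_id.
Qed.

Lemma integral_layer (k : nat) (x : \bar R) : (0 <= x)%E ->
  (\int[leb]_(s in `[0%R, +oo[)
     ((k.+1%:R * s ^+ k) * (s%:E < x)%E%:R)%:E = x ^+ k.+1)%E.
Proof.
have fin (b : R) : 0 <= b -> (\int[leb]_(s in `[0%R, +oo[)
     ((k.+1%:R * s ^+ k) * (s%:E < b%:E)%E%:R)%:E = (b ^+ k.+1)%:E)%E.
  move=> b0.
  transitivity (\int[leb]_(s in `[0%R, b[) (k.+1%:R * s ^+ k)%:E)%E.
    rewrite integral_mkcond [RHS]integral_mkcond; apply: eq_integral => s _.
    rewrite !patchE !mem_setE !in_itv/= andbT lte_fin.
    by case: (0 <= s) => //=; case: (s < b); rewrite ?mulr1 ?mulr0.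
  rewrite integral_itv_bndo_bndc; last first.
    by apply/measurable_EFinP/measurable_funTS; exact: measurable_natmul_exp.
  have dX (s : R) : is_derive s (1 : R) (fun s => s ^+ k.+1) (k.+1%:R * s ^+ k).
    apply: DeriveDef; first exact: exprn_derivable.
    by rewrite exp_derive /GRing.scale/= mulr1.
  rewrite (integral_itv0c_deriv _ _ _ b0 dX) ?expr0n ?subr0//.
  move=> s; apply: cvgM; first exact: cvg_cst.
  exact: exprn_continuous.
case: x => [b| |//].
  by rewrite lee_fin => b0; rewrite fin// EFin_expe.
have yX : (+oo ^+ k.+1 = +oo :> \bar R)%E.
  by elim: k {fin} => [//|k IHk]; rewrite expeS IHk mulyy.
(* At [x = +oo] the integral dominates the one for the finite level [A + 1], whose value
   [(A + 1) ^+ k.+1] is at least A because [A + 1] is at least 1. *)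
move=> _; rewrite yX; apply/eqyP => A A0.
have := fin (A + 1) ltac:(lra) => /esym.
pose B := A + 1.
have AB : A <= B ^+ k.+1.
  have B1 : 1 <= B by rewrite /B; lra.
  apply: (@le_trans _ _ B); first by rewrite /B; lra.
  by rewrite exprS ler_peMr ?exprn_ege1//; lra.
move=> finE; apply: (@le_trans _ _ ((A + 1) ^+ k.+1)%:E); first by rewrite lee_fin.
rewrite finE; apply: ge0_le_integral => //.
- move=> s /=; rewrite in_itv/= andbT => s0.
  by rewrite lee_fin !mulr_ge0// exprn_ge0.
- apply/measurable_EFinP/measurable_funTS/measurable_funM.
    exact: measurable_natmul_exp.
  under eq_fun do rewrite lte_fin.
  apply: (measurableT_comp (f := fun b : bool => b%:R : R)) => //.
  exact: measurable_fun_ltr.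
- apply/measurable_EFinP/measurable_funTS.
  under eq_fun do rewrite ltry mulr1.
  exact: measurable_natmul_exp.
- move=> s /=; rewrite in_itv/= andbT => s0.
  rewrite lee_fin ler_wpM2l ?mulr_ge0 ?exprn_ge0//.
  by rewrite ltry; case: (_ < _)%E.
Qed.

(** Tonelli, with [T ^+ k.+1] written as the integral of [(k+1) s^k] over [0 <= s < T]. The weight f
    serves a second use besides the moments of tau: with f a survival function and T the coordinate,
    this is the integration by parts behind [momentS]. *)
Lemma layer_cake {d} {Y : measurableType d} (m : {sfinite_measure set Y -> \bar R})
    (f T : Y -> \bar R) (k : nat) : nnmeasurable f -> nnmeasurable T ->
  (\int[m]_y (f y * T y ^+ k.+1) =
   \int[leb]_(s in `[0%R, +oo[)
     ((k.+1%:R * s ^+ k)%:E * \int[m]_y (f y * (s%:E < T y)%E%:R%:E)))%E.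
Proof.
move=> [f0 mf] [T0 mT].
pose w (s : R) := (k.+1%:R * s ^+ k) * (0 <= s)%R%:R.
have w0 s : 0 <= w s.
  by rewrite /w; case: (leP 0 s) => s0; rewrite ?mulr0 ?mulr1// mulr_ge0// exprn_ge0.
have mw : measurable_fun [set: R] w.
  apply: measurable_funM; first exact: measurable_natmul_exp.
  apply: (measurableT_comp (f := fun b : bool => b%:R : R)) => //.
  exact: measurable_fun_ler.
have mI : measurable_fun [set: Y * R] (fun z => ((z.2)%:E < T z.1)%E%:R : R).
  apply: (measurableT_comp (f := fun b : bool => b%:R : R)) => //.
  apply: (measurable_fun_bool true) => //.
  rewrite setTI (_ : _ @^-1` _ = [set z : Y * R | ((z.2)%:E < (T z.1))%E]); last by [].
  have m2 : measurable_fun [set: Y * R] (fun z => (z.2)%:E : \bar R).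
    by apply/measurable_EFinP; exact: measurable_snd.
  have m1 : measurable_fun [set: Y * R] (fun z => T z.1).
    exact: measurableT_comp mT measurable_fst.
  rewrite -[X in measurable X]setTI.
  exact: (measurable_lte measurableT m2 m1).
have mIs s : measurable_fun [set: Y] (fun y => (s%:E < T y)%E%:R%:E : \bar R).
  apply/measurable_EFinP.
  exact: (measurableT_comp (f := fun z : Y * R => ((z.2)%:E < T z.1)%E%:R : R) mI
     (g := fun y => (y, s)) (measurable_pair2 s)).
have mIy y : measurable_fun [set: R] (fun s => (s%:E < T y)%E%:R : R).
  exact: (measurableT_comp (f := fun z : Y * R => ((z.2)%:E < T z.1)%E%:R : R) mI
     (g := fun s => (y, s)) (measurable_pair1 y)).
pose h (z : Y * R) : \bar R := (f z.1 * (w z.2 * ((z.2)%:E < T z.1)%E%:R)%:E)%E.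
have h0 z : (0 <= h z)%E.
  by rewrite /h mule_ge0// lee_fin mulr_ge0//; case: (_ < _)%E.
have mh : measurable_fun [set: Y * R] h.
  apply: emeasurable_funM; first exact: measurableT_comp mf measurable_fst.
  apply/measurable_EFinP/measurable_funM => //.
  exact: measurableT_comp mw measurable_snd.
transitivity (\int[m]_y \int[leb]_s h (y, s))%E.
  apply: eq_integral => y _; rewrite -(integral_layer k _ (T0 y)).
  rewrite /h/= ge0_integralZl//; last 2 first.
  - by apply/measurable_EFinP; exact: measurable_funM mw (mIy y).
  - by move=> s _; rewrite lee_fin mulr_ge0//; case: (_ < _)%E.
  congr (_ * _)%E; rewrite [LHS]integral_mkcond.
  apply: eq_integral => s _; rewrite patchE mem_setE in_itv/= andbT /w.
  by case: (0 <= s); rewrite ?mulr0 ?mul0r ?mulr1.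
rewrite sfinite_Fubini// [RHS]integral_mkcond.
apply: eq_integral => s _; rewrite patchE mem_setE in_itv/= andbT /h/=.
under eq_integral do rewrite EFinM muleCA.
rewrite ge0_integralZl//; last 3 first.
- exact: emeasurable_funM.
- by move=> y _; rewrite mule_ge0// lee_fin; case: (_ < _)%E.
- by rewrite lee_fin.
by rewrite /w; case: (0 <= s); rewrite ?mulr1// mulr0 mul0e.
Qed.

End LayerCake.

(** * Ratio limit of a log-convex sequence *)

Section RatioLimit.
Context {R : realType}.

Lemma ln_increment_le (x y : R) : 0 < x -> 0 < y -> ln y - ln x <= (y - x) / x.
Proof.
move=> x0 y0; rewrite -ln_div ?posrE//.
have -> : y / x = 1 + (y - x) / x by field; rewrite gt_eqF.
apply: le_ln1Dx.
have -> : (y - x) / x = y / x - 1 by field; rewrite gt_eqF.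
by rewrite ltrBrDr addNr divr_gt0.
Qed.

Variable r : nat -> R.
Hypothesis r_gt0 : forall n, 0 < r n.
Hypothesis r_nondecr : forall n, n%:R * r n <= n.+1%:R * r n.+1.

(** Between n and m, [ln (r n)] can drop by at most [ln m - ln n]. The control is one-sided: windows
    after n bound [ln (r n)] from above, windows before n bound it from below. *)
Lemma ln_ratio_le (n m : nat) : (0 < n)%N -> (n <= m)%N ->
  ln (r n) - ln (r m) <= (m - n)%:R / n%:R.
Proof.
move=> n0 nm; have m0 : (0 < m)%N by exact: leq_trans nm.
have n0' : 0 < n%:R :> R by rewrite ltr0n.
have m0' : 0 < m%:R :> R by rewrite ltr0n.
have rnm : n%:R * r n <= m%:R * r m.
  rewrite -(subnK nm); elim: (m - n)%N => [|k IH]; first by rewrite add0n.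
  by rewrite addSn; exact: le_trans IH _.
have : ln (n%:R * r n) <= ln (m%:R * r m).
  by rewrite ler_ln// posrE mulr_gt0.
rewrite !lnM ?posrE// => H.
rewrite natrB//; apply: le_trans (ln_increment_le _ _ n0' m0'); lra.
Qed.

Lemma sum_ln_ratio_ge (n j : nat) : (0 < n)%N ->
  j%:R * (ln (r n) - j%:R / n%:R) <= \sum_(n <= i < n + j) ln (r i).
Proof.
move=> n0; rewrite mulr_natl -[X in _ *+ X](addKn n) -sumr_const_nat.
apply: ler_sum_nat => i /andP[ni inj].
have := ln_ratio_le _ _ n0 ni.
have : (i - n)%:R / n%:R <= j%:R / n%:R :> R.
  by rewrite ler_wpM2r ?invr_ge0// ler_nat leq_subLR ltnW.
lra.
Qed.

Lemma sum_ln_ratio_le (n j : nat) : (j < n)%N ->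
  \sum_(n - j <= i < n) ln (r i) <= j%:R * (ln (r n) + j%:R / (n - j)%:R).
Proof.
move=> jn; rewrite mulr_natl.
have -> : ((ln (r n) + j%:R / (n - j)%:R) *+ j =
    \sum_(n - j <= i < n) (ln (r n) + j%:R / (n - j)%:R))%R.
  by rewrite sumr_const_nat subKn// ltnW.
apply: ler_sum_nat => i /andP[ni inj].
have i0 : (0 < i)%N by apply: leq_trans ni; rewrite subn_gt0.
have := ln_ratio_le _ _ i0 (ltnW inj).
have : (n - i)%:R / i%:R <= j%:R / (n - j)%:R :> R.
  apply: ler_pM; rewrite ?invr_ge0 ?ler0n//.
    by rewrite ler_nat leq_subLR addnC -leq_subLR.
  by rewrite lef_pV2 ?posrE ?ltr0n ?subn_gt0// ler_nat.
lra.
Qed.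

(** Linear arithmetic on abstract reals. L stands for [ln (r n)], Sn and Sj for the partial sums at
    n and at the far end of a window of length j, X for the relative window length. Constant error,
    linear error and drift each cost a third of [j * e]. *)
Let window_up (e d c n j L ell Sn Sj X : R) :
  2 * c <= e / 3 * j -> d * (2 * n + j) <= e / 3 * j ->
  - (d * n + c) <= Sn - n * ell -> Sj - (n + j) * ell <= d * (n + j) + c ->
  j * (L - X) <= Sj - Sn -> j * X <= j * (e / 3) -> j * (L - ell) <= j * e.
Proof. lra. Qed.

Let window_lo (e d c n j L ell Sn Sj X : R) :
  2 * c <= e / 3 * j -> d * (2 * n + j) <= e / 3 * j -> 0 <= d * j ->
  - (d * n + c) <= Sn - n * ell -> Sj - (n - j) * ell <= d * (n - j) + c ->
  Sn - Sj <= j * (L + X) -> j * X <= j * (e / 3) -> j * (ell - L) <= j * e.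
Proof. lra. Qed.

(* n * r n is nondecreasing, so that ln (r n) varies by O(1/K) over windows of
   length n / K, while its averages over such windows tend to ell. *)
Lemma ratio_ln_cvg (ell : R) :
  (forall e : R, 0 < e -> exists c : R, forall n,
     `| \sum_(0 <= i < n) ln (r i) - n%:R * ell | <= e * n%:R + c) ->
  ln (r n) @[n --> \oo] --> ell.
Proof.
move=> H; apply/cvgrPdist_le => e e0.
(* Over a window of about [n / K] terms [ln (r n)] drops by at most [1 / (K - 1) <= 2 / K]; K makes
   this at most [e / 3], and the offset in [K0.+2] ensures [K <= 2 * (K - 1)]. *)
have [K0 HK0] : exists K0 : nat, 6 / e < K0%:R.
  by exists (Num.truncn (6 / e)).+1; rewrite truncnS_gt.
pose K := K0.+2.
have HK : 2 / K%:R <= e / 3 :> R.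
  rewrite ler_pdivrMr ?ltr0n// -ler_pdivrMl ?divr_gt0//.
  apply: (@le_trans _ _ K0%:R); last by rewrite ler_nat /K; lia.
  by apply: ltW; apply: le_lt_trans HK0; rewrite invf_div; lra.
(* Since [n <= 2 * K * j], the linear error [d * (2 * n + j)] is at most [d * (4 * K + 1) * j],
   which is [e / 3 * j] for this tolerance. *)
have [c Hc] := H (e / (3 * (4 * K%:R + 1)))
  ltac:(by rewrite divr_gt0// mulr_gt0// ltr_wpDl ?mulr_ge0).
set d := e / _ in Hc.
have Kgt0 : 0 < K%:R :> R by rewrite ltr0n.
have K2 : (2 <= K)%N by [].
have Kpos : (0 < K)%N by [].
have d0 : 0 < d by rewrite divr_gt0// mulr_gt0// ltr_wpDl ?mulr_ge0.
have HdK : d * (4 * K%:R + 1) = e / 3.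
  by rewrite /d; field; rewrite gt_eqF// ltr_wpDl ?mulr_ge0// ltW.
clearbody K d; pose c' := Num.max c 0.
have c'0 : 0 <= c' by rewrite le_max lexx orbT.
have Hc' n : `| \sum_(0 <= i < n) ln (r i) - n%:R * ell | <= d * n%:R + c'.
  by apply: le_trans (Hc n) _; rewrite lerD2l le_max lexx.
(* Beyond N the constant error satisfies [2 * c' <= e / 3 * j], again by [n <= 2 * K * j]. *)
have [N HN] : exists N : nat, 12 * K%:R * c' / e < N%:R.
  by exists (Num.truncn (12 * K%:R * c' / e)).+1; rewrite truncnS_gt.
near=> n.
have Kn : (K <= n)%N by near: n; exists K.
have Nn : (N <= n)%N by near: n; exists N.
pose j := (n %/ K)%N.
have j1 : (1 <= j)%N by rewrite divn_gt0.
have jK : (j * K <= n)%N by rewrite leq_trunc_div.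
have nj : (n <= 2 * K * j)%N.
  have := ltn_ceil n Kpos; rewrite -/j => ?.
  nia.
clearbody j; have n0 : (0 < n)%N by lia.
have jn : (j < n)%N by nia.
have n0R : 0 < n%:R :> R by rewrite ltr0n.
have j0R : 0 < j%:R :> R by rewrite ltr0n.
have njR : n%:R <= 2 * K%:R * j%:R :> R by rewrite -!natrM ler_nat.
have jKR : j%:R * K%:R <= n%:R :> R by rewrite -natrM ler_nat.
have cj : 2 * c' <= e / 3 * j%:R.
  have : 12 * K%:R * c' <= e * n%:R.
    rewrite [e * _]mulrC -ler_pdivrMr//; apply: ltW; apply: (lt_le_trans HN).
    by rewrite ler_nat.
  move=> h1; have h2 : e * n%:R <= e * (2 * K%:R * j%:R) by rewrite ler_pM2l.
  have : K%:R * (12 * c') <= K%:R * (2 * e * j%:R) by lra.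
  rewrite ler_pM2l//; lra.
have jn1 : j%:R / n%:R <= e / 3 :> R.
  rewrite ler_pdivrMr//; have : j%:R * 2 <= e / 3 * K%:R * j%:R :> R.
    rewrite mulrC ler_pM2r//; rewrite ler_pdivrMr// in HK.
  have : e / 3 * (j%:R * K%:R) <= e / 3 * n%:R by rewrite ler_pM2l ?divr_gt0.
  lra.
have jn2 : j%:R / (n - j)%:R <= e / 3 :> R.
  have nj0 : 0 < (n - j)%:R :> R by rewrite ltr0n subn_gt0.
  rewrite ler_pdivrMr// natrB ?(ltnW jn)//.
  have K1 : 1 <= K%:R - 1 :> R by rewrite lerBrDr (_ : 1 + 1 = 2%:R)// ler_nat.
  have h0 : j%:R * (K%:R - 1) <= n%:R - j%:R :> R by lra.
  have h1 : 1 <= e / 3 * (K%:R - 1).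
    have h : 2 <= e / 3 * K%:R by rewrite -ler_pdivrMr.
    have K2R : K%:R <= 2 * (K%:R - 1) :> R by lra.
    have : e / 3 * K%:R <= e / 3 * (2 * (K%:R - 1)) by rewrite ler_pM2l ?divr_gt0.
    lra.
  have h2 : e / 3 * (j%:R * (K%:R - 1)) <= e / 3 * (n%:R - j%:R).
    by rewrite ler_pM2l ?divr_gt0.
  have h3 : j%:R * 1 <= j%:R * (e / 3 * (K%:R - 1)) :> R by rewrite ler_pM2l.
  lra.
have dj : d * (2 * n%:R + j%:R) <= e / 3 * j%:R.
  have : d * (2 * n%:R + j%:R) <= d * ((4 * K%:R + 1) * j%:R).
    have : 2 * n%:R + j%:R <= (4 * K%:R + 1) * j%:R :> R by clear -njR; lra.
    by rewrite (ler_pM2l d0).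
  by rewrite mulrA HdK.
pose S m : R := \sum_(0 <= i < m) ln (r i).
have S1 : S (n + j)%N - S n = \sum_(n <= i < n + j) ln (r i).
  by rewrite /S (big_cat_nat (n := n))//= ?leq_addr// addrAC subrr add0r.
have S2 : S n - S (n - j)%N = \sum_(n - j <= i < n) ln (r i).
  by rewrite /S (big_cat_nat (n := (n - j)%N))//= ?leq_subr// addrAC subrr add0r.
have := sum_ln_ratio_ge n j n0; rewrite -S1.
have := sum_ln_ratio_le n j jn; rewrite -S2.
have := Hc' n; have := Hc' (n + j)%N; have := Hc' (n - j)%N.
rewrite -!/(S _) !ler_norml natrD natrB ?(ltnW jn)//.
move=> /andP[a1 a2] /andP[b1 b2] /andP[c1 c2] LE GE.
have u1 : j%:R * (j%:R / n%:R) <= j%:R * (e / 3) :> R by rewrite ler_pM2l.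
have u2 : j%:R * (j%:R / (n - j)%:R) <= j%:R * (e / 3) :> R by rewrite ler_pM2l.
rewrite natrB ?(ltnW jn)// in u2.
have dj' : 0 <= d * j%:R by rewrite mulr_ge0// ltW.
have up := window_up _ _ _ _ _ _ _ _ _ _ cj dj c1 b2 GE u1.
have lo := window_lo _ _ _ _ _ _ _ _ _ _ cj dj dj' c1 a2 LE u2.
rewrite !(ler_pM2l j0R) in up lo.
by apply/andP; split=> //; rewrite -opprB lerN2.
Unshelve. all: by end_near. Qed.

End RatioLimit.

(** * Iterated tail integrals *)

Section ExpIntegrals.
Context {R : realType}.
Local Notation leb := (@lebesgue_measure R).

Lemma is_derive_expRM (c x : R) :
  is_derive x (1 : R) (fun x => expR (c * x)) (c * expR (c * x)).
Proof.
have d1 : is_derive x (1 : R) (fun x => c * x) c.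
  by apply: is_derive_eq; rewrite /GRing.scale/= mulr1.
have := @is_derive1_comp _ expR (fun x => c * x) x _ _ (is_derive_expR (c * x)) d1.
by rewrite mulrC.
Qed.

Lemma continuous_expRM (c : R) : continuous (fun x : R => expR (c * x)).
Proof.
move=> x; apply: (@continuous_comp _ _ _ (fun x => c * x) expR).
  by apply: cvgM; [exact: cvg_cst|exact: cvg_id].
exact: continuous_expR.
Qed.

Lemma measurable_expRM (D : set R) (K c : R) :
  measurable_fun D (fun x : R => (K * expR (c * x))%:E).
Proof.
apply/measurable_EFinP/measurable_funTS/measurable_funM; first exact: measurable_cst.
by apply: continuous_measurable_fun; exact: continuous_expRM.
Qed.

Lemma measurable_EFin_expRM (D : set R) (c : R) :
  measurable_fun D (fun x : R => (expR (c * x))%:E).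
Proof.
apply/measurable_EFinP/measurable_funTS.
by apply: continuous_measurable_fun; exact: continuous_expRM.
Qed.

Lemma integral_expRM_itv0c (c b : R) : 0 <= b -> c != 0 ->
  (\int[leb]_(x in `[0%R, b]) (expR (c * x))%:E = ((expR (c * b) - 1) / c)%:E)%E.
Proof.
move=> b0 c0.
have dF (x : R) : is_derive x (1 : R) (fun x => c^-1 * expR (c * x)) (expR (c * x)).
  have := is_derive_expRM c x => dx.
  by apply: is_derive_eq; rewrite /GRing.scale/= mulrA mulVf// mul1r.
rewrite (integral_itv0c_deriv _ _ _ b0 dF); last exact: continuous_expRM.
by rewrite mulr0 expR0 mulr1 mulrC -[X in _ - X]mul1r -mulrBl.
Qed.

Lemma integral_expR_tail (c s : R) : 0 < c ->
  (\int[leb]_(x in `[s, +oo[) (expR (- c * x))%:E = (expR (- c * s) / c)%:E)%E.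
Proof.
move=> c0; have c1 : - c != 0 by rewrite oppr_eq0 gt_eqF.
have dF (x : R) :
    is_derive x (1 : R) (fun x => - c^-1 * expR (- c * x)) (expR (- c * x)).
  have := is_derive_expRM (- c) x => dx.
  by apply: is_derive_eq; rewrite /GRing.scale/= mulrA mulrNN mulVf ?gt_eqF// mul1r.
have cF : continuous (fun x : R => - c^-1 * expR (- c * x)).
  move=> x; apply: cvgM; first exact: cvg_cst.
  exact: continuous_expRM.
rewrite (@ge0_continuous_FTC2y _ _ (fun x => - c^-1 * expR (- c * x)) _ 0)//.
- by rewrite sub0e -EFinN mulNr opprK mulrC.
- by apply: continuous_subspaceT; exact: continuous_expRM.
- rewrite -(mulr0 (- c^-1)); apply: cvgM; first exact: cvg_cst.
  under eq_fun do rewrite mulNr.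
  apply: (cvg_comp (fun x => c * x) (fun y => expR (- y))).
    exact: gt0_cvgMry.
  exact: cvgr_expR.
- exact/cvg_at_right_filter/cF.
- by move=> x _; rewrite derive1E; exact: (@derive_val _ _ _ _ _ _ _ (dF x)).
Qed.

End ExpIntegrals.

Section IteratedTails.
Context {R : realType}.
Local Notation leb := (@lebesgue_measure R).

Variables (u : nat -> R -> R) (lam : R).
Hypothesis lam_gt0 : 0 < lam.
Hypothesis u01 : forall n s, 0 <= u n s <= 1.
Hypothesis u_noninc : forall n, nonincreasing_fun (u n).

Let tail (n : nat) (s : R) : \bar R := (\int[leb]_(t in `[s, +oo[) (u n t)%:E)%E.
Let r n := fine (tail n 0%R).

(** The relation is conditional because [Phi] takes its default value unless the mean of tau is
    positive and finite. Starting from the exponential bounds on [u 0], induction removes the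
    condition for every n ([tail_fin]). *)
Hypothesis u_rel : forall n, (0 < tail n 0%R < +oo)%E ->
  forall s : R, 0 <= s -> ((r n * u n.+1 s)%:E = tail n s)%E.
Hypothesis u_upper : forall kap : R, 0 < kap -> kap < lam ->
  exists2 C : R, 0 < C & forall s : R, 0 <= s -> u 0 s <= C * expR (- kap * s).
Hypothesis u_lower : forall kap : R, lam < kap ->
  exists2 C : R, 0 < C & forall s : R, 0 <= s -> C * expR (- kap * s) <= u 0 s.

Lemma measurable_iterate n (D : set R) : measurable_fun D (u n).
Proof.
apply: measurable_funTS; apply: nonincreasing_measurable => //; exact: u_noninc.
Qed.

Lemma emeasurable_iterate n (D : set R) :
  measurable_fun D (fun t => (u n t)%:E : \bar R).
Proof.
by apply/measurable_EFinP; exact: measurable_iterate.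
Qed.

Lemma emeasurable_iterateZ n (D : set R) b :
  measurable_fun D (fun t => (b * u n t)%:E : \bar R).
Proof.
apply/measurable_EFinP/measurable_funM; first exact: measurable_cst.
exact: measurable_iterate.
Qed.

Lemma tail_scale n s b : 0 <= b ->
  (b%:E * tail n s = \int[leb]_(t in `[s, +oo[) (b * u n t)%:E)%E.
Proof.
move=> b0; rewrite /tail -ge0_integralZl_EFin//; first last.
- exact: emeasurable_iterate.
- by move=> t _; rewrite lee_fin; have /andP[] := u01 n t.
Qed.

Lemma tail_exp (K kap s : R) : 0 < kap -> 0 <= K ->
  (\int[leb]_(t in `[s, +oo[) (K * expR (- kap * t))%:E =
   (K / kap * expR (- kap * s))%:E)%E.
Proof.
move=> kap0 K0; under eq_integral do rewrite EFinM.
rewrite ge0_integralZl_EFin//; last first.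
  exact: measurable_EFin_expRM.
rewrite integral_expR_tail// -EFinM; congr EFin; ring.
Qed.

(** An exponential is an eigenfunction of the tail integral: the rate is kept and the constant is
    divided by kap. The factor b makes room for the product [a n], so that the normalisations [r n]
    never have to be divided out. *)
Lemma tail_upper n (b K kap : R) : 0 < kap -> 0 <= b -> 0 <= K ->
  (forall s : R, 0 <= s -> b * u n s <= K * expR (- kap * s)) ->
  forall s : R, 0 <= s -> (b%:E * tail n s <= (K / kap * expR (- kap * s))%:E)%E.
Proof.
move=> kap0 b0 K0 H s s0; rewrite tail_scale// -tail_exp//; apply: ge0_le_integral => //.
- by move=> t _; rewrite lee_fin mulr_ge0//; have /andP[] := u01 n t.
- exact: emeasurable_iterateZ.
- exact: measurable_expRM.
- move=> t /=; rewrite in_itv/= andbT => st.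
  by rewrite lee_fin H// (le_trans s0).
Qed.

Lemma tail_lower n (b K kap : R) : 0 < kap -> 0 <= b -> 0 <= K ->
  (forall s : R, 0 <= s -> K * expR (- kap * s) <= b * u n s) ->
  forall s : R, 0 <= s -> ((K / kap * expR (- kap * s))%:E <= b%:E * tail n s)%E.
Proof.
move=> kap0 b0 K0 H s s0; rewrite tail_scale// -tail_exp//; apply: ge0_le_integral => //.
- by move=> t _; rewrite lee_fin mulr_ge0// expR_ge0.
- exact: measurable_expRM.
- exact: emeasurable_iterateZ.
- move=> t /=; rewrite in_itv/= andbT => st.
  by rewrite lee_fin H// (le_trans s0).
Qed.

(* In the application, [a n] is [E_nu[tau ^ n] / n!]. *)
Let a n := \prod_(0 <= i < n) r i.

(** Invariant of the induction: the upper bound makes the tail integral finite, the lower bound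
    makes it positive, and [u_rel] then hands both to the next index. *)
Let exp_bounded n := 0 < a n /\
  (forall kap : R, 0 < kap -> kap < lam -> exists2 C : R, 0 < C &
     forall s : R, 0 <= s -> a n * u n s <= C * expR (- kap * s)) /\
  (forall kap : R, lam < kap -> exists2 C : R, 0 < C &
     forall s : R, 0 <= s -> C * expR (- kap * s) <= a n * u n s).

Let exp_bounded_fin n : exp_bounded n -> (0 < tail n 0%R < +oo)%E.
Proof.
have lam0 := lam_gt0; move=> [a0 [up lo]]; apply/andP; split.
- have l2 : lam < 2 * lam by lra.
  have [C C0 HC] := lo _ l2.
  have k0 : 0 < 2 * lam by lra.
  have := tail_lower n (a n) C (2 * lam) k0 (ltW a0) (ltW C0) HC 0 (lexx 0).
  rewrite mulr0 expR0 mulr1 => H.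
  rewrite -(pmule_rgt0 _ (_ : 0 < (a n)%:E)%E) ?lte_fin//.
  by apply: lt_le_trans H; rewrite lte_fin divr_gt0.
- have k0 : 0 < lam / 2 by lra.
  have l2 : lam / 2 < lam by lra.
  have [C C0 HC] := up _ k0 l2.
  have := tail_upper n (a n) C (lam / 2) k0 (ltW a0) (ltW C0) HC 0 (lexx 0).
  case E : (tail n 0%R) => [x| |] //.
    by rewrite ltry.
  by rewrite gt0_muley ?lte_fin.
Qed.

Let exp_boundedP n : exp_bounded n.
Proof.
have lam0 := lam_gt0.
elim: n => [|n IH].
  rewrite /exp_bounded /a big_nil; split=> //.
  split=> kap.
  - move=> k0 kl; have [C C0 HC] := u_upper _ k0 kl.
    by exists C => // s s0; rewrite mul1r HC.
  - move=> kl; have [C C0 HC] := u_lower _ kl.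
    by exists C => // s s0; rewrite mul1r HC.
have fin := exp_bounded_fin _ IH; have rel := u_rel _ fin.
have [a0 [up lo]] := IH.
have r0 : 0 < r n by rewrite fine_gt0// fin.
have mean_prodS : a n.+1 = a n * r n by rewrite /a big_nat_recr.
rewrite /exp_bounded mean_prodS; split; first by rewrite mulr_gt0.
split=> kap.
- move=> k0 kl; have [C C0 HC] := up _ k0 kl.
  exists (C / kap); first by rewrite divr_gt0.
  move=> s s0; rewrite -lee_fin -(mulrA (a n)) (EFinM (a n)) rel//.
  exact: (tail_upper n (a n) C kap k0 (ltW a0) (ltW C0) HC s s0).
- move=> kl; have [C C0 HC] := lo _ kl.
  have k0 : 0 < kap by lra.
  exists (C / kap); first by rewrite divr_gt0.
  move=> s s0; rewrite -lee_fin -(mulrA (a n)) (EFinM (a n)) rel//.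
  exact: (tail_lower n (a n) C kap k0 (ltW a0) (ltW C0) HC s s0).
Qed.

Lemma tail_fin n : (0 < tail n 0%R < +oo)%E.
Proof. exact: exp_bounded_fin. Qed.

Lemma tail0E n : tail n 0%R = (r n)%:E.
Proof. by have /andP[h0 hy] := tail_fin n; rewrite /r fineK// ge0_fin_numE// ltW. Qed.

Lemma mean_gt0 n : 0 < r n.
Proof. by rewrite fine_gt0// tail_fin. Qed.

(** [u 0 0] may be smaller than 1, since nu may charge the crowded set. From index 1 on the value is
    1, so that bounds on [a n * u n s] can be read at [s = 0] as bounds on [a n]. *)
Lemma iterateS0 n : u n.+1 0 = 1.
Proof.
apply: (mulfI (lt0r_neq0 (mean_gt0 n))); apply: EFin_inj.
by rewrite mulr1 u_rel ?tail_fin// tail0E.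
Qed.

Lemma mean_prod_gt0 n : 0 < a n. Proof. by case: (exp_boundedP n). Qed.

Lemma mean_prodS n : a n.+1 = a n * r n. Proof. by rewrite /a big_nat_recr. Qed.

(** Unlike in [exp_bounded], C is uniform in n and the dependence on n is the explicit power of kap;
    after taking logarithms, C costs only an additive constant. *)
Lemma mean_prod_upper (kap : R) : 0 < kap -> kap < lam ->
  exists2 C : R, 0 < C & forall n s, 0 <= s ->
    a n * u n s <= C / kap ^+ n * expR (- kap * s).
Proof.
move=> k0 kl; have [C C0 HC] := u_upper _ k0 kl; exists C => //.
elim=> [|n IH] s s0; first by rewrite /a big_nil expr0 mul1r divr1 HC.
rewrite mean_prodS -lee_fin -(mulrA (a n)) (EFinM (a n)) u_rel// ?tail_fin//.
have := tail_upper n (a n) _ kap k0 (ltW (mean_prod_gt0 n)) _ IH s s0.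
rewrite exprS invfM mulrA (mulrAC C) -mulrA; apply.
by rewrite divr_ge0// ?exprn_ge0// ltW.
Qed.

Lemma mean_prod_lower (kap : R) : lam < kap ->
  exists2 C : R, 0 < C & forall n s, 0 <= s ->
    C / kap ^+ n * expR (- kap * s) <= a n * u n s.
Proof.
have lam0 := lam_gt0; move=> kl; have k0 : 0 < kap by lra.
have [C C0 HC] := u_lower _ kl; exists C => //.
elim=> [|n IH] s s0; first by rewrite /a big_nil expr0 mul1r divr1 HC.
rewrite mean_prodS -lee_fin -(mulrA (a n)) (EFinM (a n)) u_rel// ?tail_fin//.
have := tail_lower n (a n) _ kap k0 (ltW (mean_prod_gt0 n)) _ IH s s0.
rewrite exprS invfM mulrA (mulrAC C) -mulrA; apply.
by rewrite divr_ge0// ?exprn_ge0// ltW.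
Qed.

Lemma sum_ln_mean n : \sum_(0 <= i < n) ln (r i) = ln (a n).
Proof.
elim: n => [|n IH]; first by rewrite /a !big_nil ln1.
by rewrite big_nat_recr//= IH mean_prodS lnM ?posrE ?mean_prod_gt0 ?mean_gt0.
Qed.

Lemma sum_ln_mean_bound (e : R) : 0 < e -> exists c : R, forall n,
  `| \sum_(0 <= i < n) ln (r i) - n%:R * - ln lam | <= e * n%:R + c.
Proof.
move=> e0.
(* The rates [lam * exp (- e)] and [lam * exp e] turn [ln (kap ^+ n)] into [n * (ln lam - e)] and
   [n * (ln lam + e)]. *)
have [C1 C10 H1] := mean_prod_upper (lam * expR (- e))
  ltac:(by rewrite mulr_gt0// expR_gt0) ltac:(by rewrite gtr_pMr// expR_lt1 oppr_lt0).
have [C2 C20 H2] := mean_prod_lower (lam * expR e) ltac:(by rewrite ltr_pMr// expR_gt1).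
have lnk (x : R) n : ln ((lam * expR x) ^+ n) = n%:R * (ln lam + x).
  by rewrite lnXn ?mulr_gt0 ?expR_gt0// lnM ?posrE ?expR_gt0// expRK mulr_natl.
have kn0 x n : 0 < (lam * expR x) ^+ n by rewrite exprn_gt0// mulr_gt0 ?expR_gt0.
exists (`|ln C1| + `|ln C2|) => n; rewrite sum_ln_mean.
have c1 := ler_norm (ln C1); have c2 := ler_norm (- ln C2).
have n1 := normr_ge0 (ln C1); have n2 := normr_ge0 (ln C2).
rewrite normrN in c2.
case: n => [|n].
  by rewrite /a big_nil ln1 mul0r subr0 normr0 mulr0 add0r addr_ge0.
have := H1 n.+1 0 (lexx 0); have := H2 n.+1 0 (lexx 0).
rewrite iterateS0 !mulr0 expR0 !mulr1 => lo up.
have {}lo : ln C2 - n.+1%:R * (ln lam + e) <= ln (a n.+1).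
  by rewrite -lnk -ln_div ?posrE// ler_ln// posrE ?divr_gt0// mean_prod_gt0.
have {}up : ln (a n.+1) <= ln C1 - n.+1%:R * (ln lam - e).
  by rewrite -lnk -ln_div ?posrE// ler_ln// posrE ?divr_gt0// mean_prod_gt0.
rewrite ler_norml; apply/andP; split; lra.
Qed.

(** * Moments of the iterates and convergence of the means *)

Let mom (k n : nat) : \bar R := (\int[leb]_(s in `[0%R, +oo[) (s ^+ k * u n s)%:E)%E.

(** Integration by parts, through [layer_cake] with density [u n] and the coordinate as T: the
    integral of [u n] beyond s is [r n * u n.+1 s]. *)
Lemma momentS k n : ((k.+1%:R * r n)%:E * mom k n.+1 = mom k.+1 n)%E.
Proof.
pose w (x : R) : \bar R := ((u n x) * (0 <= x)%R%:R)%:E.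
have bm : measurable_fun [set: R] (fun x : R => (0 <= x)%R%:R : R).
  apply: (measurableT_comp (f := fun b : bool => b%:R : R)) => //.
  exact: measurable_fun_ler.
have nw : nnmeasurable w.
  split=> [x|]; first by rewrite lee_fin mulr_ge0//; have /andP[] := u01 n x.
  by apply/measurable_EFinP; exact: measurable_funM (measurable_iterate n _) bm.
have nT : nnmeasurable (fun x : R => (Num.max x 0)%:E : \bar R).
  split=> [x|]; first by rewrite lee_fin le_max lexx orbT.
  by apply/measurable_EFinP; exact: measurable_maxr.
have LC := layer_cake leb w _ k nw nT.
transitivity (\int[leb]_x (w x * (Num.max x 0)%:E ^+ k.+1))%E; last first.
  rewrite /mom [RHS]integral_mkcond; apply: eq_integral => x _.
  rewrite /w -EFin_expe -EFinM patchE mem_setE in_itv/= andbT.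
  case: (leP 0 x) => x0; rewrite ?mulr0 ?mul0r//.
  by rewrite mulr1 mulrC.
rewrite LC /mom -ge0_integralZl_EFin//; last 3 first.
- move=> s /=; rewrite in_itv/= andbT => s0.
  by rewrite lee_fin mulr_ge0 ?exprn_ge0//; have /andP[] := u01 n.+1 s.
- apply/measurable_EFinP/measurable_funM.
    by apply: measurable_funTS; exact: measurable_funX.
  exact: measurable_iterate.
- by rewrite mulr_ge0// ltW// mean_gt0.
apply: eq_integral => s; rewrite mem_setE in_itv/= andbT => s0.
have -> : (\int[leb]_y (w y * (s%:E < (Num.max y 0)%:E)%E%:R%:E) = tail n s)%E.
  rewrite /tail -integral_itv_obnd_cbnd; last exact: emeasurable_iterate.
  rewrite [RHS]integral_mkcond; apply: eq_integral => x _.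
  rewrite patchE mem_setE in_itv/= andbT /w lte_fin lt_max [s < 0]ltNge s0 orbF.
  case: (ltP s x) => sx; last by rewrite mule0.
  by rewrite mule1 (le_trans s0 (ltW sx)) mulr1.
rewrite -u_rel ?tail_fin// -!EFinM; congr EFin; ring.
Qed.

Lemma momentE k n : mom k n = (k`!%:R * \prod_(0 <= i < k.+1) r (n + i)%N)%:E.
Proof.
elim: k n => [|k IH] n.
  rewrite big_nat1 addn0 fact0 mul1r -tail0E /mom /tail.
  by apply: eq_integral => s _; rewrite expr0 mul1r.
rewrite -momentS IH -EFinM factS natrM [in RHS]big_nat_recl// addn0; congr EFin.
under [in RHS]eq_bigr do rewrite addnS -addSn.
ring.
Qed.

Lemma mean_nondecr n : n%:R * r n <= n.+1%:R * r n.+1.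
Proof.
case: n => [|k]; first by rewrite mul0r mul1r ltW// mean_gt0.
pose m j := j`!%:R * \prod_(0 <= i < j.+1) r (0 + i)%N.
have mE j : mom j 0 = (m j)%:E by rewrite momentE.
have m0 j : 0 < m j.
  rewrite /m mulr_gt0 ?ltr0n ?fact_gt0//.
  by apply: prodr_gt0 => i _; exact: mean_gt0.
have mS j : m j.+1 = m j * (j.+1%:R * r j.+1).
  by rewrite /m factS natrM big_nat_recr//= add0n; ring.
(* This is [m k.+1 / m k], the value that minimises [c ^+ 2 * m k - 2 * c * m k.+1], so that the
   quadratic inequality below amounts to Cauchy-Schwarz. *)
pose c := k.+1%:R * r k.+1; have c0 : 0 < c by rewrite mulr_gt0// mean_gt0.
(* integrate [s ^ k * (s - c) ^ 2 * u 0 s >= 0] *)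
have CS : (2 * c) * m k.+1 <= c ^+ 2 * m k + m k.+2.
  have mpow (j : nat) (b : R) : measurable_fun (`[0%R, +oo[%classic : set R)
      (fun s : R => (b * (s ^+ j * u 0%N s))%:E : \bar R).
    apply/measurable_EFinP/measurable_funM => //; apply: measurable_funM.
      by apply: measurable_funTS; exact: measurable_funX.
    exact: measurable_iterate.
  have pge0 (j : nat) (b s : R) : 0 <= b -> (`[0%R, +oo[%classic : set R) s ->
      (0 <= (b * (s ^+ j * u 0%N s))%:E :> \bar R)%E.
    move=> b0; rewrite /= in_itv/= andbT => s0; rewrite lee_fin !mulr_ge0 ?exprn_ge0//.
    by have /andP[] := u01 0 s.
  have momZ j (b : R) : 0 <= b -> ((b * m j)%:E =
      \int[leb]_(s in `[0%R, +oo[) (b * (s ^+ j * u 0 s))%:E)%E.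
    move=> b0; rewrite EFinM -mE -ge0_integralZl_EFin//.
    - by move=> s Ds; have := pge0 j 1 s ler01 Ds; rewrite mul1r.
    - apply/measurable_EFinP/measurable_funM; last exact: measurable_iterate.
      by apply: measurable_funTS; exact: measurable_funX.
  rewrite -lee_fin EFinD -[m k.+2]mul1r !momZ ?sqr_ge0//; last by rewrite mulr_ge0// ltW.
  rewrite -ge0_integralD//; last 4 first.
  - by move=> s; apply: pge0; exact: sqr_ge0.
  - exact: mpow.
  - by move=> s; exact: pge0.
  - exact: mpow.
  apply: ge0_le_integral => //.
  - by move=> s; apply: pge0; rewrite mulr_ge0// ltW.
  - exact: mpow.
  - by apply: emeasurable_funD; exact: mpow.
  - move=> s /=; rewrite in_itv/= andbT => s0; rewrite -EFinD lee_fin.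
    have : 0 <= s ^+ k * u 0 s * (s - c) ^+ 2.
      apply: mulr_ge0; last exact: sqr_ge0.
      by apply: mulr_ge0; [exact: exprn_ge0|have /andP[] := u01 0 s].
    rewrite !exprS; lra.
move: CS; rewrite !mS -/c => CS.
have : m k * c * c <= m k * c * (k.+2%:R * r k.+2) by lra.
by rewrite (ler_pM2l (mulr_gt0 (m0 k) c0)).
Qed.

Lemma mean_cvg : r n @[n --> \oo] --> lam^-1.
Proof.
have := ratio_ln_cvg r mean_gt0 mean_nondecr (- ln lam) sum_ln_mean_bound => H.
have -> : lam^-1 = expR (- ln lam) by rewrite expRN lnK.
have -> : r = fun n => expR (ln (r n)).
  by apply/funext => n; rewrite lnK// posrE mean_gt0.
by apply: continuous_cvg H; exact: continuous_expR.
Qed.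

Lemma moment_cvg k : mom k n @[n --> \oo] --> (k`!%:R / lam ^+ k.+1)%:E.
Proof.
rewrite [X in X @ _ --> _](_ : _ =
    fun n => (k`!%:R * \prod_(0 <= i < k.+1) r (n + i)%N)%:E); last first.
  by apply/funext => n; exact: momentE.
apply: cvg_EFin; first by near=> n.
apply: cvgM; first exact: cvg_cst.
elim: k => [|k IH].
  by under eq_fun do rewrite big_nat1 addn0; rewrite expr1; exact: mean_cvg.
under eq_fun do rewrite big_nat_recr//=.
rewrite exprSr invfM; apply: cvgM => //.
by rewrite (cvg_shiftn k.+1); exact: mean_cvg.
Unshelve. all: by end_near. Qed.

(** * Contraction towards the exponential law *)

Let D n s := `|u n s - expR (- lam * s)|.

(** [u n.+1] is 1 minus [1 / r n] times the integral of [u n], and the exponential is 1 minus lam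
    times its own integral. Inherited error: lam times the integral of [exp (2 * lam * t)] gives the
    factor 1/2, whence the rate of the weight. Error from [1 / r n] differing from lam: the integral
    v of [u n] is at most s, hence at most [exp (2 * lam * s) / (2 * lam)]. *)
Lemma iterate_contraction n c : 0 <= c ->
  (forall s : R, 0 <= s -> D n s <= c * expR (2 * lam * s)) ->
  forall s : R, 0 <= s -> D n.+1 s <=
    (c / 2 + `|lam - (r n)^-1| / (2 * lam)) * expR (2 * lam * s).
Proof.
move=> c0 H s s0.
set E := expR (2 * lam * s).
pose V := (\int[leb]_(t in `[0%R, s]) (u n t)%:E)%E.
have V0 : (0 <= V)%E.
  by apply: integral_ge0 => t _; rewrite lee_fin; have /andP[] := u01 n t.
have Vs : (V <= s%:E)%E.
  apply: (@le_trans _ _ (\int[leb]_(t in `[0%R, s]) 1))%E.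
    apply: ge0_le_integral => //.
    - by move=> t _; rewrite lee_fin; have /andP[] := u01 n t.
    - exact: emeasurable_iterate.
    - by move=> t _; rewrite lee_fin; have /andP[] := u01 n t.
  rewrite integral_cst//= mul1e lebesgue_measure_itv/= lte_fin.
  by case: ltP; rewrite ?sube0 ?lee_fin.
have Vfin : V = (fine V)%:E by rewrite fineK// ge0_fin_numE// (le_lt_trans Vs)// ltry.
set v := fine V in Vfin.
have v0 : 0 <= v by rewrite -lee_fin -Vfin.
have vs : v <= s by rewrite -lee_fin -Vfin.
have split_tail : r n = v + r n * u n.+1 s.
  apply: EFin_inj; rewrite EFinD u_rel ?tail_fin// -Vfin -tail0E /tail.
  rewrite -[in RHS]integral_itv_obnd_cbnd; last exact: emeasurable_iterate.
  rewrite /V -ge0_integral_setU//.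
  - by rewrite -itv_bndbnd_setU// bnd_simp.
  - exact: emeasurable_iterate.
  - by move=> t _; rewrite lee_fin; have /andP[] := u01 n t.
  - apply/disj_set2P/seteqP; split=> // t [/=]; rewrite !in_itv/= andbT.
    by move=> /andP[_ ts] st; have := lt_le_trans st ts; rewrite ltxx.
have l2 : 2 * lam != 0 by rewrite gt_eqF// mulr_gt0.
have expE : (\int[leb]_(t in `[0%R, s]) (expR (- lam * t))%:E =
    ((1 - expR (- lam * s)) / lam)%:E)%E.
  rewrite integral_expRM_itv0c ?oppr_eq0 ?gt_eqF//; congr EFin.
  by rewrite invrN mulrN -mulNr opprB.
have exp2E : (\int[leb]_(t in `[0%R, s]) (c * expR (2 * lam * t))%:E =
    (c * ((E - 1) / (2 * lam)))%:E)%E.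
  under eq_integral do rewrite EFinM.
  rewrite ge0_integralZl_EFin//; last first.
    exact: measurable_EFin_expRM.
  by rewrite integral_expRM_itv0c// EFinM.
have mexp : measurable_fun (`[0%R, s]%classic : set R)
    (fun t : R => (expR (- lam * t))%:E : \bar R).
  exact: measurable_EFin_expRM.
have mexp2 : measurable_fun (`[0%R, s]%classic : set R)
    (fun t : R => (c * expR (2 * lam * t))%:E : \bar R).
  exact: measurable_expRM.
have e0 (t : R) : (0 <= (expR (- lam * t))%:E)%E by rewrite lee_fin expR_ge0.
have e20 (t : R) : (0 <= (c * expR (2 * lam * t))%:E)%E.
  by rewrite lee_fin mulr_ge0// expR_ge0.
have un0 t : (0 <= (u n t)%:E)%E by rewrite lee_fin; have /andP[] := u01 n t.
have up : v <= (1 - expR (- lam * s)) / lam + c * ((E - 1) / (2 * lam)).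
  rewrite -lee_fin EFinD -expE -exp2E -Vfin -ge0_integralD//.
  apply: ge0_le_integral => //.
  - exact: emeasurable_iterate.
  - exact: emeasurable_funD.
  - move=> t /=; rewrite in_itv/= => /andP[t0 _]; rewrite -EFinD lee_fin.
    by have := H _ t0; rewrite /D ler_norml => /andP[_]; rewrite lerBlDl.
have lo : (1 - expR (- lam * s)) / lam <= v + c * ((E - 1) / (2 * lam)).
  rewrite -lee_fin EFinD -expE -exp2E -Vfin -ge0_integralD//; last first.
    exact: emeasurable_iterate.
  apply: ge0_le_integral => //.
  - by apply: emeasurable_funD => //; exact: emeasurable_iterate.
  - move=> t /=; rewrite in_itv/= => /andP[t0 _]; rewrite -EFinD lee_fin.
    by have := H _ t0; rewrite /D ler_norml => /andP[]; rewrite lerBrDl addrC => h _; lra.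
have rn := mean_gt0 n.
set e := expR (- lam * s) in up lo *.
set q := (r n)^-1.
have uE : u n.+1 s = 1 - q * v.
  apply: (mulfI (lt0r_neq0 rn)); rewrite mulrBr mulr1 mulrA divff ?gt_eqF// mul1r.
  by rewrite {2}split_tail addrAC subrr add0r.
have E1 : 2 * lam * s <= E by apply: le_trans (expR_ge1Dx _); rewrite lerDr.
rewrite /D uE -/e.
have -> : 1 - q * v - e = lam * ((1 - e) / lam - v) + (lam - q) * v.
  by clearbody q; field; rewrite gt_eqF.
apply: le_trans (ler_normD _ _) _.
rewrite [leRHS]mulrDl; apply: lerD; last first.
  rewrite normrM (ger0_norm v0) -mulrA; apply: ler_wpM2l => //.
  rewrite mulrC ler_pdivlMr ?mulr_gt0//.
  by apply: le_trans E1; rewrite mulrC ler_pM2l ?mulr_gt0.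
rewrite normrM gtr0_norm//.
have h : `|(1 - e) / lam - v| <= c * ((E - 1) / (2 * lam)).
  by rewrite ler_norml; apply/andP; split; lra.
apply: (@le_trans _ _ (lam * (c * ((E - 1) / (2 * lam))))); first by rewrite ler_pM2l.
have -> : lam * (c * ((E - 1) / (2 * lam))) = c / 2 * (E - 1).
  by field; rewrite gt_eqF.
by rewrite ler_wpM2l ?divr_ge0// gerBl.
Qed.

Lemma iterate_cvg s : 0 <= s -> u n s @[n --> \oo] --> expR (- lam * s).
Proof.
move=> s0.
have q_cvg : `|lam - (r n)^-1| / (2 * lam) @[n --> \oo] --> 0.
  rewrite -(mul0r (2 * lam)^-1); apply: cvgM; last exact: cvg_cst.
  have d_cvg : lam - (r n)^-1 @[n --> \oo] --> (0 : R).
    rewrite -(subrr lam); apply: cvgB; first exact: cvg_cst.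
    rewrite -[X in _ --> X]invrK; apply: cvgV; first by rewrite invr_eq0 gt_eqF.
    exact: mean_cvg.
  by move/cvg_norm : d_cvg; rewrite normr0.
apply/cvgrPdist_le => e e0.
(* Once [2^-m <= 2 * d], the bound [(2^-m + 2 * d) * exp (2 * lam * s)] obtained below is at most
   e. *)
pose d := e / (4 * expR (2 * lam * s)).
have E0 : 0 < expR (2 * lam * s) by exact: expR_gt0.
have d0 : 0 < d by rewrite divr_gt0// mulr_gt0.
have [N _ HN] : \forall n \near \oo, `|lam - (r n)^-1| / (2 * lam) <= d.
  move/cvgrPdist_le : q_cvg => /(_ d d0); apply: filterS => n.
  by rewrite sub0r normrN ger0_norm// divr_ge0// mulr_ge0// ltW.
(* [2 * d] is the fixed point of [c |-> c / 2 + d]. The induction starts with the constant 1, as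
   both functions lie in [[0, 1]]. *)
have HD m x : 0 <= x -> D (N + m)%N x <= (2^-1 ^+ m + 2 * d) * expR (2 * lam * x).
  elim: m x => [|m IH] x x0.
    rewrite addn0 expr0 /D.
    have e1 : expR (- lam * x) <= 1.
      by rewrite -expR0 ler_expR mulNr oppr_le0 mulr_ge0// ltW.
    have ep := expR_gt0 (- lam * x).
    have /andP[ua ub] := u01 N x.
    apply: (@le_trans _ _ 1); first by rewrite ler_norml; apply/andP; split; lra.
    have h1 : 1 <= expR (2 * lam * x).
      by rewrite -expR0 ler_expR mulr_ge0// mulr_ge0// ltW.
    apply: (le_trans h1); rewrite ler_peMl//; lra.
  rewrite addnS.
  have p0 : 0 <= 2^-1 ^+ m :> R by rewrite exprn_ge0// invr_ge0.
  have c0 : 0 <= 2^-1 ^+ m + 2 * d by lra.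
  apply: le_trans (iterate_contraction _ _ c0 IH x x0) _.
  rewrite ler_pM2r ?expR_gt0//.
  have := HN (N + m)%N (leq_addr _ _); rewrite /= exprS; lra.
have half_cvg : (2^-1 : R) ^+ m @[m --> \oo] --> 0.
  by apply: cvg_expr; rewrite ger0_norm ?invr_ge0// invf_lt1// ltr1n.
have [M _ HM] : \forall m \near \oo, (2^-1 : R) ^+ m <= 2 * d.
  move/cvgrPdist_le : half_cvg => /(_ (2 * d)); rewrite mulr_gt0// => /(_ isT).
  by apply: filterS => n; rewrite sub0r normrN ger0_norm// exprn_ge0// invr_ge0.
exists (N + M)%N => // n /= NMn.
rewrite distrC -/(D n s).
have -> : n = (N + (n - N))%N by lia.
apply: le_trans (HD _ _ s0) _.
have := HM (n - N)%N; rewrite /= => /(_ ltac:(lia)) hm.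
have -> : e = 4 * d * expR (2 * lam * s) by rewrite /d; field; rewrite gt_eqF.
rewrite ler_pM2r//; lra.
Qed.

End IteratedTails.

(** * Hitting times and the Markov property *)

Section Crowded.
Context {d : nat}.

Lemma measurable_coord (i : site d) :
  measurable_fun [set: config d] (fun eta : config d => (eta i : nat)).
Proof.
move=> _ B mB; rewrite setTI.
by apply: sub_sigma_algebra; exists i, B.
Qed.

Lemma measurable_crowded (L : {fset site d}) (k0 : int) :
  measurable (crowded L k0 : set (config d)).
Proof.
have msum (s : seq (site d)) :
    measurable_fun [set: config d]
      (fun eta : config d => (\sum_(i <- s) (eta i : nat))%N).
  elim: s => [|i s IHs].
    rewrite [X in measurable_fun _ X](_ : _ = cst 0%N); first exact: measurable_cst.
    by apply/funext => eta; rewrite big_nil.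
  rewrite [X in measurable_fun _ X](_ : _ =
      fun eta : config d => ((eta i : nat) + \sum_(i <- s) (eta i : nat))%N).
    by apply: measurable_fun_addn => //; exact: measurable_coord.
  by apply/funext => eta; rewrite big_cons.
have := msum (enum_fset L) measurableT [set n : nat | k0 < n%:Z] I.
by rewrite setTI.
Qed.

End Crowded.

Section KilledProcess.
Context {R : realType} {d : nat}.
Context {dW : measure_display} {W : measurableType dW}.
Variables (p : site d -> site d -> R) (b : nat -> nat -> R).
Variables (X : R -> W -> config d) (P : R.-pker (config d) ~> W).
Variable S : set (config d).
Hypothesis hX : is_process p b X P S.
Variables (L : {fset site d}) (k0 : int).
Local Notation A := (crowded L k0).
Local Notation tau := (tau X A).

Let mA : measurable A := measurable_crowded L k0.

(** Occupation numbers are integers, so right continuity makes each of them constant just after t,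
    and A depends on finitely many of them. *)
Lemma crowded_right_cont w t : 0 <= t ->
  \forall s \near t^'+, A (X s w) <-> A (X t w).
Proof.
move=> t0.
suff H : \forall s \near t^'+, forall i, i \in enum_fset L -> X s w i = X t w i.
  apply: filterS H => s Hs; rewrite /crowded /=.
  by rewrite (eq_big_seq (fun i => X t w i)).
elim: (enum_fset L) => [|i s IHs]; first by apply: nearW => s i.
have Hi : \forall s \near t^'+, X s w i = X t w i.
  have rc := proc_right_cont hX (w := w) (i := i) t0.
  exact: rc _ (discrete_set1 _).
apply: filterS2 Hi IHs => u ui us j; rewrite inE => /predU1P[->//|]; exact: us.
Qed.

Lemma tau_ge0 w : (0 <= tau w)%E.
Proof. by apply: le_ereal_inf_tmp => _ [t [t0 _] <-]; rewrite lee_fin. Qed.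

(** The strict inequality matches the closed interval [[0, t]]: a path outside A up to time t stays
    outside for some further time e, so the infimum is at least [t + e]. *)
Lemma tau_gtP w t : 0 <= t ->
  (t%:E < tau w)%E <-> forall s, 0 <= s <= t -> ~ A (X s w).
Proof.
move=> t0; split=> [tw s /andP[s0 st] As|H].
  move: tw; apply/negP; rewrite -leNgt; apply: (@le_trans _ _ s%:E).
    by apply: ereal_inf_lbound; exists s.
  by rewrite lee_fin.
have nAt : ~ A (X t w) by apply: H; rewrite t0 lexx.
have [e /= e0 He] := crowded_right_cont w t t0.
apply: (@lt_le_trans _ _ (t + e)%:E); first by rewrite lte_fin ltrDl.
apply: le_ereal_inf_tmp => _ [s [s0 As] <-]; rewrite lee_fin leNgt; apply/negP => ste.
have [st|ts] := leP s t; first by apply: (H s) => //; rewrite s0 st.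
apply: nAt; apply/(He s) => //=.
by rewrite /ball/= distrC gtr0_norm ?subr_gt0// ltrBlDl.
Qed.

(** The instant s itself is left out: in the Markov property it belongs to the past, and the first
    grid point can then be peeled off as in [no_hitS]. *)
Definition no_hit (s h : R) (k : nat) : set W :=
  [set w | forall i, (0 < i <= k)%N -> ~ A (X (s + i%:R * h) w)].

Lemma no_hitS s h k :
  no_hit s h k.+1 = X (s + h) @^-1` (~` A) `&` no_hit (s + h) h k.
Proof.
apply/seteqP; split=> w /=.
  move=> H; split; first by have := H 1%N isT; rewrite mul1r.
  move=> i /andP[i0 ik]; have := H i.+1 ik.
  by rewrite -natr1 mulrDl mul1r [_ * h + h]addrC addrA.
move=> [H1 H] [//|[|i]] ik; first by rewrite mul1r.
have -> : s + i.+2%:R * h = s + h + i.+1%:R * h by rewrite -[in LHS]natr1; ring.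
exact: H.
Qed.

(** A visit to A at [s + r] with [r < t] lasts for some time, so a fine grid meets it at its first
    point after r. This recovers even [r = 0], which no grid contains; [r = t] is itself a grid
    point. *)
Lemma no_hit_grid s t w : 0 <= s -> 0 < t ->
  (forall r, 0 <= r <= t -> ~ A (X (s + r) w)) <->
  (forall n, no_hit s (t / 2 ^+ n) (2 ^ n) w).
Proof.
move=> s0 t0; have pow0 n : 0 < 2 ^+ n :> R by rewrite exprn_gt0.
split=> [H n i /andP[i0 ik]|H r /andP[r0 rt] Ar].
  apply: H; rewrite mulr_ge0 ?divr_ge0 ?(ltW t0) ?(ltW (pow0 n))//=.
  rewrite mulrA ler_pdivrMr// mulrC ler_pM2l//.
  by rewrite -natrX ler_nat.
move: rt; rewrite le_eqVlt => /predU1P[rt|rt].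
  by apply: (H 0%N 1%N isT); rewrite expr0 divr1 mul1r -rt.
have sr0 : 0 <= s + r by rewrite addr_ge0.
have [e /= e0 He] := crowded_right_cont w (s + r) sr0.
have [n Hn] : exists n : nat, t / e < n%:R.
  by exists (Num.truncn (t / e)).+1; rewrite truncnS_gt.
have Hn2 : t / 2 ^+ n < e.
  rewrite ltr_pdivrMr// mulrC -ltr_pdivrMr//; apply: (lt_le_trans Hn).
  by rewrite -natrX ler_nat ltnW// ltn_expl.
pose i := (Num.truncn (r * 2 ^+ n / t)).+1.
have y0 : 0 <= r * 2 ^+ n / t.
  by rewrite divr_ge0 ?(ltW t0)// mulr_ge0// ltW.
have /andP[i1 i2] := truncn_itv y0.
have hi1 : r < i%:R * (t / 2 ^+ n).
  by rewrite mulrA ltr_pdivlMr// -ltr_pdivrMr.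
have hi2 : i%:R * (t / 2 ^+ n) <= r + t / 2 ^+ n.
  rewrite /i -natr1 mulrDl mul1r lerD2r mulrA ler_pdivrMr//.
  by rewrite -ler_pdivlMr.
have ik : (i <= 2 ^ n)%N.
  rewrite -(ltr_nat R) natrX; apply: (le_lt_trans i1).
  by rewrite ltr_pdivrMr// mulrC ltr_pM2l.
apply: (H n i); first by rewrite ik.
apply/(He (s + i%:R * (t / 2 ^+ n))) => //=.
- rewrite /ball/= opprD addrACA subrr add0r distrC gtr0_norm ?subr_gt0//.
  by rewrite ltrBlDl (le_lt_trans hi2)// ltrD2l.
- by rewrite ltrD2l.
Qed.

Lemma no_hit_nonincr s t :
  nonincreasing_seq (fun n => no_hit s (t / 2 ^+ n) (2 ^ n)).
Proof.
apply/nonincreasing_seqP => n; apply/subsetPset => w H i /andP[i0 ik].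
have := H (i * 2)%N; rewrite natrM exprS.
have -> : i%:R * 2 * (t / (2 * 2 ^+ n)) = i%:R * (t / 2 ^+ n) :> R.
  by field; rewrite expf_neq0.
by apply; rewrite muln_gt0 i0/= expnS mulnC leq_mul2l ik orbT.
Qed.

Section History.
Variable s : R.
Hypothesis s0 : 0 <= s.

Let HT := g_sigma_algebraType [set F | exists (u : R) (B : set (config d)),
  [/\ 0 <= u <= s, measurable B & F = X u @^-1` B]].

Lemma history_measurable F : history X s F -> measurable F.
Proof.
apply: smallest_sub; first exact: sigma_algebra_measurable.
move=> _ [u [B [/andP[u0 _] mB ->]]].
by rewrite -[X in measurable X]setTI; exact: (proc_measurable hX).
Qed.

Lemma historyI F G : history X s F -> history X s G -> history X s (F `&` G).
Proof. exact: (@measurableI _ HT). Qed.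

Lemma history_bigcap (F : nat -> set W) :
  (forall n, history X s (F n)) -> history X s (\bigcap_n F n).
Proof. exact: (@bigcapT_measurable _ HT). Qed.

Lemma historyT : history X s setT.
Proof. exact: (@measurableT _ HT). Qed.

Lemma history_preimage u B : 0 <= u <= s -> measurable B ->
  history X s (X u @^-1` B).
Proof. by move=> us mB; apply: sub_sigma_algebra; exists u, B. Qed.

End History.

Lemma history_le s t F : s <= t -> history X s F -> history X t F.
Proof.
move=> st; apply: sub_sigma_algebra2 => _ [u [B [/andP[u0 us] mB ->]]].
by exists u, B; rewrite u0 (le_trans us).
Qed.

Lemma history_no_hit s h k t : 0 <= s -> 0 <= h -> s + k%:R * h <= t ->
  history X t (no_hit s h k).
Proof.
elim: k s => [|k IHk] s s0 h0 kt.
  by rewrite (_ : no_hit _ _ _ = setT); [exact: historyT|apply/seteqP; split=> // w _ []].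
have kt' : s + h + k%:R * h <= t by move: kt; rewrite -natr1 mulrDl mul1r; lra.
rewrite no_hitS; apply: historyI; last by apply: IHk => //; rewrite addr_ge0.
apply: history_preimage; last exact: measurableC.
rewrite addr_ge0//=; apply: le_trans kt'.
by rewrite lerDl mulr_ge0.
Qed.

Lemma no_hit_limit s t : 0 <= s -> 0 < t ->
  [set w | forall r, 0 <= r <= t -> ~ A (X (s + r) w)] =
  \bigcap_n no_hit s (t / 2 ^+ n) (2 ^ n).
Proof.
move=> s0 t0; apply/seteqP; split=> w.
  by move=> H n _; exact: (no_hit_grid s t w s0 t0).1.
by move=> H; apply/(no_hit_grid s t w s0 t0) => n; exact: H.
Qed.

(** Only grid times in [[0, t]] enter, so survival up to t is known at time t and may serve as the
    past event of the Markov property. *)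
Lemma history_tau_gt t : 0 <= t -> history X t [set w | (t%:E < tau w)%E].
Proof.
move=> t0.
have -> : [set w | (t%:E < tau w)%E] =
    X 0 @^-1` (~` A) `&` [set w | forall r, 0 <= r <= t -> ~ A (X (0 + r) w)].
  apply/seteqP; split=> w /=.
    move/(tau_gtP w t t0) => H; split=> [|r rt]; first by apply: H; rewrite lexx.
    by rewrite add0r; exact: H.
  by move=> [_ H]; apply/(tau_gtP w t t0) => r rt; have := H r rt; rewrite add0r.
apply: historyI; first by apply: history_preimage; [rewrite lexx|exact: measurableC].
move: t0; rewrite le_eqVlt => /predU1P[<-|t0].
  rewrite (_ : [set w | _] = X 0 @^-1` (~` A)).
    by apply: history_preimage; [rewrite lexx|exact: measurableC].
  apply/seteqP; split=> w /=.
    by move=> H; have := H 0; rewrite lexx addr0; exact.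
  move=> H r; rewrite add0r => /andP[r0 r0']; suff -> : r = 0 by [].
  by apply/eqP; rewrite eq_le r0 r0'.
rewrite no_hit_limit//; apply: history_bigcap => n.
apply: history_no_hit => //; first by rewrite divr_ge0 ?exprn_ge0// ltW.
by rewrite add0r natrX mulrC divfK// expf_neq0.
Qed.

Lemma measurable_tau_gt t : measurable [set w | (t%:E < tau w)%E].
Proof.
have [t0|t0] := leP 0 t; first exact: history_measurable (history_tau_gt t t0).
rewrite (_ : [set w | _] = setT)//; apply/seteqP; split=> // w _ /=.
by apply: lt_le_trans (tau_ge0 w); rewrite lte_fin.
Qed.

Lemma measurable_tau : measurable_fun [set: W] tau.
Proof.
apply: (measurability _ (ErealGenOInfty.measurableE R)) => //.
move=> _ [_ [x ->] <-]; rewrite setTI.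
rewrite (_ : _ @^-1` _ = [set w | (x%:E < tau w)%E]); first exact: measurable_tau_gt.
by apply/seteqP; split=> w /=; rewrite in_itv/= andbT.
Qed.

End KilledProcess.

(** * Markov property for the hitting time *)

Section MarkovProperty.
Context {R : realType} {d : nat}.
Context {dW : measure_display} {W : measurableType dW}.
Variables (p : site d -> site d -> R) (b : nat -> nat -> R).
Variables (X : R -> W -> config d) (P : R.-pker (config d) ~> W).
Variable S : set (config d).
Hypothesis hX : is_process p b X P S.
Variables (L : {fset site d}) (k0 : int).
Local Notation A := (crowded L k0).
Local Notation tau := (tau X A).
Local Notation no_hit := (no_hit X L k0).

Let mX t : 0 <= t -> measurable_fun setT (X t).
Proof. by move=> t0; exact: (proc_measurable hX t0). Qed.

Let mAC : measurable (~` A : set (config d)).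
Proof. by apply: measurableC; exact: measurable_crowded. Qed.

Lemma measurable_kernel_comp s F : 0 <= s -> measurable F ->
  measurable_fun [set: W] (fun w => P (X s w) F).
Proof.
move=> s0 mF; exact: (measurableT_comp (measurable_kernel P F mF) (mX s s0)).
Qed.

Lemma measurable_kernel_integral s (f : W -> \bar R) : 0 <= s -> nnmeasurable f ->
  measurable_fun [set: W] (fun w => \int[P (X s w)]_v f v)%E.
Proof.
move=> s0 [f0 mf].
apply: (measurableT_comp _ (mX s s0) (f := fun x => (\int[P x]_v f v)%E)).
by apply: measurable_fun_integral_kernel => // U mU; exact: measurable_kernel.
Qed.

Lemma markov_integral eta s t F (f : config d -> \bar R) : S eta -> 0 <= s -> 0 <= t ->
  history X s F -> nnmeasurable f ->
  (\int[P eta]_(w in F) f (X (s + t) w) =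
   \int[P eta]_(w in F) \int[P (X s w)]_v f (X t v))%E.
Proof.
move=> Seta s0 t0 hF.
have mF := history_measurable _ _ _ _ _ hX _ _ hF.
have st0 : 0 <= s + t by rewrite addr_ge0.
apply: (posfun_ext (fun f => \int[P eta]_(w in F) (f \o X (s + t)) w)%E
  (fun f => \int[P eta]_(w in F) \int[P (X s w)]_v (f \o X t) v)%E).
- apply: (posfun_comp (fun g => \int[P eta]_(w in F) g w)%E); first exact: mX.
  exact: posfun_integral.
- apply: (posfun_mixture (P eta) F
    (fun w f => \int[P (X s w)]_v (f \o X t) v)%E) => //.
    move=> w _; apply: (posfun_comp (fun g => \int[P (X s w)]_v g v)%E).
      exact: mX.
    exact: posfun_integral.
  move=> g mg; apply: measurable_funTS; apply: measurable_kernel_integral => //.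
  by apply: nnmeasurable_comp => //; exact: mX.
- move=> B mB; have mXB u : 0 <= u -> measurable (X u @^-1` B).
    by move=> u0; rewrite -[X in measurable X]setTI; exact: mX.
  transitivity (P eta (X (s + t) @^-1` B `&` F)).
    by rewrite -integral_indic//; exact: mXB.
  rewrite setIC (proc_markov hX)//; apply: eq_integral => w _.
  by rewrite -[X t @^-1` B]setIT -integral_indic//; exact: mXB.
Qed.

Lemma measurable_no_hit s h k : 0 <= s -> 0 <= h -> measurable (no_hit s h k).
Proof.
move=> s0 h0; apply: (history_measurable _ _ _ _ _ hX (s + k%:R * h)).
exact: history_no_hit.
Qed.

Lemma ae_state eta t : S eta -> 0 <= t -> {ae P eta, forall w, S (X t w)}.
Proof. by move=> Seta t0; apply: filterS (proc_state hX Seta) => w; exact. Qed.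

(** Induction on the number of grid points, moving the event that [X (s + h)] lies outside A into
    the past; eta, s and F therefore vary in the induction. *)
Lemma markov_no_hit h k eta s F : S eta -> 0 <= s -> 0 <= h -> history X s F ->
  (P eta (F `&` no_hit s h k) = \int[P eta]_(w in F) P (X s w) (no_hit 0 h k))%E.
Proof.
move=> + + h0; elim: k eta s F => [|k IHk] eta s F Seta s0 hF;
  have mF := history_measurable _ _ _ _ _ hX _ _ hF.
  have no_hit0 u : no_hit u h 0 = setT.
    by apply/seteqP; split=> // w _ [].
  rewrite !no_hit0 setIT -[LHS]mul1e -integral_cst//; apply: eq_integral => w _.
  by rewrite prob_kernel.
have sh0 : 0 <= s + h by rewrite addr_ge0.
pose G x := P x (no_hit 0 h k).
have mG : nnmeasurable (fun x => (G x * (\1_(~` A) x)%:E)%E : \bar R).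
  split=> [x|]; first by rewrite mule_ge0// lee_fin.
  apply: emeasurable_funM; first exact/measurable_kernel/measurable_no_hit.
  exact/measurable_EFinP/measurable_indic.
(* Applied twice: at [(eta, s, F)], and at [(X s w, 0, setT)]. The latter requires [X s w] in S,
   which holds for almost every w, so the integrands are compared almost everywhere. *)
have step eta' u F' : S eta' -> 0 <= u -> history X u F' ->
    (P eta' (F' `&` no_hit u h k.+1) =
     \int[P eta']_(w in F') (G (X (u + h) w) * (\1_(~` A) (X (u + h) w))%:E))%E.
  move=> Seta' u0 hF'; have uh0 : 0 <= u + h by rewrite addr_ge0.
  rewrite no_hitS setIA IHk//; last first.
    apply: historyI => //; first by apply: history_le hF'; rewrite lerDl.
    by apply: history_preimage => //; rewrite uh0/=.
  rewrite -/(G _) integral_mkcondr; apply: eq_integral => w _.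
  rewrite /patch/= indicE.
  have [Aw|nAw] := pselect ((~` A) (X (u + h) w)).
    by rewrite !mem_set// mule1.
  by rewrite !memNset// mule0.
rewrite step// (markov_integral _ _ _ _ (fun x => (G x * (\1_(~` A) x)%:E)%E))//.
apply: ge0_ae_eq_integral => //.
- apply: measurable_funTS; apply: measurable_kernel_integral => //.
  exact: nnmeasurable_comp (mX h h0) mG.
- apply: measurable_funTS; apply: measurable_kernel_comp => //.
  exact: measurable_no_hit.
- move=> w _; apply: integral_ge0 => v _; exact: mG.1.
- apply: filterS (ae_state eta s Seta s0) => w Sw _.
  by rewrite -(setTI (no_hit _ _ _)) step//; [rewrite add0r|exact: historyT].
Qed.

Lemma no_hit_cvg (m : {measure set W -> \bar R}) s t F : (m setT < +oo)%E ->
  0 <= s -> 0 < t -> measurable F ->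
  m (F `&` no_hit s (t / 2 ^+ n) (2 ^ n)) @[n --> \oo] -->
  m (F `&` [set w | forall r, 0 <= r <= t -> ~ A (X (s + r) w)]).
Proof.
move=> moo s0 t0 mF; rewrite (no_hit_limit _ _ _ _ _ hX)//.
have -> : F `&` \bigcap_n no_hit s (t / 2 ^+ n) (2 ^ n) =
    \bigcap_n (F `&` no_hit s (t / 2 ^+ n) (2 ^ n)).
  by rewrite bigcapIr//; exists 0%N.
have mN n : measurable (F `&` no_hit s (t / 2 ^+ n) (2 ^ n)).
  apply: measurableI => //; apply: measurable_no_hit => //.
  by rewrite divr_ge0 ?exprn_ge0// ltW.
apply: nonincreasing_cvg_mu => //.
- by apply: le_lt_trans moo; apply: le_measure; rewrite ?inE.
- exact: bigcapT_measurable.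
- move=> i j ij; apply/subsetPset => w [Fw Nw]; split=> //.
  by have /subsetPset := no_hit_nonincr X L k0 s t _ _ ij; apply.
Qed.

Lemma tau_gtD s t w : 0 <= s -> 0 <= t ->
  ((s + t)%:E < tau w)%E <->
  (s%:E < tau w)%E /\ forall r, 0 <= r <= t -> ~ A (X (s + r) w).
Proof.
move=> s0 t0; have st0 : 0 <= s + t by rewrite addr_ge0.
split=> [/(tau_gtP _ _ _ _ _ hX _ _ _ _ st0) H|].
  split=> [|r /andP[r0 rt]]; last by apply: H; rewrite addr_ge0//= lerD2l.
  apply/(tau_gtP _ _ _ _ _ hX _ _ _ _ s0) => r /andP[r0 rs]; apply: H.
  by rewrite r0/= (le_trans rs)// lerDl.
move=> [/(tau_gtP _ _ _ _ _ hX _ _ _ _ s0) H1 H2].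
apply/(tau_gtP _ _ _ _ _ hX _ _ _ _ st0) => r /andP[r0 rst].
have [rs|sr] := leP r s; first by apply: H1; rewrite r0.
have := H2 (r - s); rewrite subrKC; apply; rewrite subr_ge0 ltW//=.
by rewrite lerBlDl.
Qed.

(** Limit of [markov_no_hit] along dyadic grids: continuity from above on the left, dominated
    convergence with bound 1 on the right. The grids need [0 < t]; for [t = 0] the Markov property
    at a single time suffices. *)
Lemma markov_tau eta s t : S eta -> 0 <= s -> 0 <= t ->
  (P eta [set w | ((s + t)%:E < tau w)%E] =
   \int[P eta]_(w in [set w | (s%:E < tau w)%E])
     P (X s w) [set v | (t%:E < tau v)%E])%E.
Proof.
move=> Seta s0 t0.
set F := [set w | (s%:E < tau w)%E].
have hF : history X s F by exact: (history_tau_gt _ _ _ _ _ hX).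
have mF := history_measurable _ _ _ _ _ hX _ _ hF.
have mtau u := measurable_tau_gt _ _ _ _ _ hX L k0 u.
have -> : [set w | ((s + t)%:E < tau w)%E] =
    F `&` [set w | forall r, 0 <= r <= t -> ~ A (X (s + r) w)].
  by apply/seteqP; split=> w /=; move/(tau_gtD s t w s0 t0).
move: t0; rewrite le_eqVlt => /predU1P[<-|t0].
  have -> : [set w | forall r, 0 <= r <= 0 -> ~ A (X (s + r) w)] =
      X (s + 0) @^-1` (~` A).
    apply/seteqP; split=> w /= H; first by apply: H; rewrite lexx.
    by move=> r r0; rewrite (_ : r = 0)//; apply/eqP; rewrite eq_sym eq_le.
  rewrite (proc_markov hX)//; apply: eq_integral => w _; congr (P _ _).
  apply/seteqP; split=> v /=.
    move=> H; apply/(tau_gtP _ _ _ _ _ hX _ _ _ _ (lexx 0)) => r r0.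
    by rewrite (_ : r = 0)//; apply/eqP; rewrite eq_sym eq_le.
  by move/(tau_gtP _ _ _ _ _ hX _ _ _ _ (lexx 0)); apply; rewrite lexx.
have tauE : [set v | (t%:E < tau v)%E] =
    setT `&` [set v | (0%:E < tau v)%E] `&`
    [set w | forall r, 0 <= r <= t -> ~ A (X (0 + r) w)].
  apply/seteqP; split=> v /=.
    by rewrite -{1}(add0r t) => /(tau_gtD 0 t v (lexx 0) (ltW t0))[v1 v2].
  by move=> [[_ v1] v2]; rewrite -(add0r t); exact/(tau_gtD 0 t v (lexx 0) (ltW t0)).
have Pfin x : (P x setT < +oo)%E by rewrite prob_kernel ltry.
have h0 n : 0 <= t / 2 ^+ n :> R by rewrite divr_ge0 ?exprn_ge0// ltW.
have lhs := no_hit_cvg (P eta) s t F (Pfin eta) s0 t0 mF.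
have pw x : P x (no_hit 0 (t / 2 ^+ n) (2 ^ n)) @[n --> \oo] -->
    P x [set v | (t%:E < tau v)%E].
  rewrite [X in X @ _ --> _](_ : _ =
      (fun n => P x (setT `&` no_hit 0 (t / 2 ^+ n) (2 ^ n)))); last first.
    by apply/funext => n; rewrite setTI.
  rewrite (_ : [set v | (t%:E < tau v)%E] =
      setT `&` [set w | forall r, 0 <= r <= t -> ~ A (X (0 + r) w)]).
    exact: no_hit_cvg.
  rewrite tauE -setIA; congr (_ `&` _); apply/seteqP; split=> v /= => [[]//|H].
  split=> //; apply/(tau_gtP _ _ _ _ _ hX _ _ _ _ (lexx 0)) => r /andP[r0 r0'].
  by have := H r; rewrite add0r; apply; rewrite r0 (le_trans r0')// ltW.
have rhs : P eta (F `&` no_hit s (t / 2 ^+ n) (2 ^ n)) @[n --> \oo] -->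
    (\int[P eta]_(w in F) P (X s w) [set v | (t%:E < tau v)%E])%E; last first.
  by rewrite -(cvg_lim _ lhs)// -(cvg_lim _ rhs).
rewrite [X in X @ _ --> _](_ : _ =
  (fun n => \int[P eta]_(w in F) P (X s w) (no_hit 0 (t / 2 ^+ n) (2 ^ n)))%E); last first.
  by apply/funext => n; exact: markov_no_hit.
have [] := @dominated_convergence _ _ _ (P eta) F mF
  (fun n w => P (X s w) (no_hit 0 (t / 2 ^+ n) (2 ^ n)))
  (fun w => P (X s w) [set v | (t%:E < tau v)%E]) (cst 1%E) => //.
- move=> n; apply: measurable_funTS; apply: measurable_kernel_comp => //.
  exact: measurable_no_hit.
- by apply: measurable_funTS; exact: measurable_kernel_comp.
- by apply/aeW => w _; exact: pw.
- apply/integrableP; split; first exact: measurable_cst.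
  rewrite (eq_integral (cst 1%E)) => [|w _]; last by rewrite /= normr1.
  rewrite integral_cst// mul1e; apply: le_lt_trans (Pfin eta).
  by apply: le_measure; rewrite ?inE.
- apply/aeW => w n _; rewrite gee0_abs//.
  by rewrite -(prob_kernel (s := P) (X s w)) le_measure ?inE//; exact: measurable_no_hit.
Qed.

End MarkovProperty.

(** * The map Phi *)

Section PathLaw.
Local Open Scope ereal_scope.
Context {R : realType} {d : nat}.
Context {dW : measure_display} {W : measurableType dW}.
Variables (P : R.-pker (config d) ~> W) (mu : probability (config d) R).

Let Pmu0 : Pmu P mu set0 = 0.
Proof. by apply: integral0_eq => eta _; rewrite measure0. Qed.

Let Pmu_ge0 F : 0 <= Pmu P mu F.
Proof. exact: integral_ge0. Qed.

Let Pmu_sigma_additive : semi_sigma_additive (Pmu P mu).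
Proof.
move=> F mF tF mUF; rewrite [X in _ --> X](_ : _ =
  \int[mu]_eta \sum_(n <oo) P eta (F n)); last first.
  apply: eq_integral => eta _.
  by apply/esym/cvg_lim => //; exact: measure_semi_sigma_additive.
apply/cvg_closeP; split.
  by apply: is_cvg_nneseries => n _ _; exact: integral_ge0.
by rewrite closeE// integral_nneseries// => n; exact: measurable_kernel.
Qed.

HB.instance Definition _ := isMeasure.Build _ _ _ (Pmu P mu)
  Pmu0 Pmu_ge0 Pmu_sigma_additive.

Let PmuT : Pmu P mu setT = 1.
Proof.
rewrite /Pmu (eq_integral (cst 1)) => [|eta _]; last by rewrite prob_kernel.
by rewrite integral_cst// mul1e; exact: probability_setT.
Qed.

HB.instance Definition _ := Measure_isProbability.Build _ _ _ (Pmu P mu) PmuT.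

Definition path_law : probability W R := Pmu P mu.

Lemma integral_path_law (F : set W) (f : W -> \bar R) : measurable F -> nnmeasurable f ->
  \int[path_law]_(w in F) f w = \int[mu]_eta \int[P eta]_(w in F) f w.
Proof.
move=> mF; apply: (posfun_ext (fun f => \int[path_law]_(w in F) f w)
  (fun f => \int[mu]_eta \int[P eta]_(w in F) f w)).
- exact: posfun_integral.
- apply: (posfun_mixture mu setT (fun eta f => \int[P eta]_(w in F) f w)) => //.
    by move=> eta _; exact: posfun_integral.
  move=> g [g0 mg].
  rewrite [X in measurable_fun _ X](_ : _ = fun eta => \int[P eta]_w (g \_ F) w).
    apply: measurable_fun_integral_kernel => [U mU|w|].
    + exact: measurable_kernel.
    + by rewrite patchE; case: ifP.
    + by apply/(measurable_restrictT _ _).1 => //; exact: measurable_funTS.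
  by apply/funext => eta; rewrite integral_mkcond.
- move=> B mB; rewrite integral_indic//; apply: eq_integral => eta _.
  by rewrite integral_indic.
Qed.

End PathLaw.

(** * The killed process and existence of the image under Phi *)

Section KilledLaw.
Context {R : realType} {d : nat}.
Context {dW : measure_display} {W : measurableType dW}.
Variables (p : site d -> site d -> R) (b : nat -> nat -> R).
Variables (X : R -> W -> config d) (P : R.-pker (config d) ~> W).
Variable S : set (config d).
Hypothesis hX : is_process p b X P S.
Variables (L : {fset site d}) (k0 : int).
Local Notation A := (crowded L k0).
Local Notation tau := (tau X A).
Local Notation leb := (@lebesgue_measure R).

Let mX t : 0 <= t -> measurable_fun setT (X t).
Proof. by move=> t0; exact: (proc_measurable hX t0). Qed.

Let mtau : measurable_fun [set: W] tau := measurable_tau _ _ _ _ _ hX L k0.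

Let mtau_gt t : measurable [set w | (t%:E < tau w)%E].
Proof. exact: (measurable_tau_gt _ _ _ _ _ hX). Qed.

(** The process is constrained at nonnegative times only; freezing it at its time 0 value for
    negative times gives a map that is jointly measurable on the whole product. *)
Let Xp (z : R * W) : config d := X (Num.max z.1 0) z.2.

(* By right continuity, [X t w i] is the eventual value of [X u w i] along the
   grid points [u = (floor (2 ^ n t) + 1) / 2 ^ n] following [t]. *)
Lemma measurable_joint : measurable_fun [set: R * W] Xp.
Proof.
have mE0 : @measurable _ (config d) = <<s @cylinders d >> by [].
apply: (@measurability _ _ _ (config d) setT Xp (@cylinders d) mE0).
move=> _ [_ [i [B ->]] <-].
rewrite setTI.
pose fl n (t : R) := (Num.truncn (Num.max t 0 * 2 ^+ n)).+1.
pose E n k := [set z : R * W | fl n z.1 = k /\ B (X (k%:R / 2 ^+ n) z.2 i)].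
have mE n k : measurable (E n k).
  have -> : E n k = [set t | fl n t = k] `*` [set w | B (X (k%:R / 2 ^+ n) w i)].
    by apply/seteqP; split.
  apply: measurableX.
    have mm : measurable_fun [set: R] (fun t : R => Num.max t 0 * 2 ^+ n).
      by apply: measurable_funM => //; exact: measurable_maxr.
    case: k => [|k].
      by rewrite (_ : [set t | _] = set0)//; apply/seteqP; split.
    have -> : [set t | fl n t = k.+1] =
        (fun t : R => Num.max t 0 * 2 ^+ n) @^-1` `[k%:R, k.+1%:R[%classic.
      apply/seteqP; split=> t; rewrite /fl /= in_itv/=.
        move=> [<-]; apply: truncn_itv; rewrite mulr_ge0 ?exprn_ge0//.
        by rewrite le_max lexx orbT.
      by move=> kt; congr (_.+1); apply: truncn_def.
    by rewrite -[X in measurable X]setTI; apply: mm.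
  have k2 : 0 <= k%:R / 2 ^+ n :> R by rewrite divr_ge0 ?exprn_ge0.
  have := mX _ k2 measurableT [set eta : config d | B (eta i)].
  rewrite setTI; apply; apply: sub_sigma_algebra; by exists i, B.
(* The values at the grid points agree with [Xp z i] from some index on, so the event is the lower
   limit of the countable unions of [E n k]. *)
have -> : Xp @^-1` [set eta | B (eta i)] =
    \bigcup_N \bigcap_(n in [set n | (N <= n)%N]) \bigcup_k E n k.
  have key (z : R * W) : exists N, forall n, (N <= n)%N ->
      X ((fl n z.1)%:R / 2 ^+ n) z.2 i = Xp z i.
    set t := Num.max z.1 0.
    have t0 : 0 <= t by rewrite le_max lexx orbT.
    have rc := proc_right_cont hX (w := z.2) (i := i) t0.
    have [e /= e0 He] := rc _ (discrete_set1 _).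
    have [N HN] : exists N : nat, e^-1 < N%:R.
      by exists (Num.truncn e^-1).+1; rewrite truncnS_gt.
    exists N => n Nn; apply: He => /=; last first.
      by rewrite /fl -/t ltr_pdivlMr ?exprn_gt0// truncnS_gt.
    have pow0 : 0 < 2 ^+ n :> R by rewrite exprn_gt0.
    have y0 : 0 <= t * 2 ^+ n by rewrite mulr_ge0// ltW.
    have /andP[i1 i2] := truncn_itv y0.
    have h1 : t < (fl n z.1)%:R / 2 ^+ n by rewrite ltr_pdivlMr.
    have h2 : (fl n z.1)%:R / 2 ^+ n <= t + (2 ^+ n)^-1.
      rewrite ler_pdivrMr// mulrDl mulVf ?gt_eqF//.
      by rewrite /fl -natr1 lerD2r.
    have h3 : (2 ^+ n)^-1 < e.
      rewrite -[e]invrK ltf_pV2 ?posrE ?invr_gt0//.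
      apply: (lt_le_trans HN); rewrite -natrX ler_nat (leq_trans Nn)//.
      exact/ltnW/ltn_expl.
    rewrite /ball/= distrC gtr0_norm ?subr_gt0//.
    by rewrite ltrBlDl (le_lt_trans h2)// ltrD2l.
  apply/seteqP; split=> z.
    move=> Bz; have [N HN] := key z; exists N => // n Nn.
    by exists (fl n z.1) => //; split=> //; rewrite HN.
  move=> [N _ H]; have [M HM] := key z.
  have [k _ [fk Bk]] := H (maxn N M) (leq_maxl _ _).
  by rewrite /= -(HM (maxn N M) (leq_maxr _ _)) fk.
apply: bigcupT_measurable => N; apply: bigcap_measurableType => n _.
exact: bigcupT_measurable.
Qed.

Lemma measurable_killed_fun (f : config d -> \bar R) : nnmeasurable f ->
  nnmeasurable (fun z : R * W =>
    (f (Xp z) * ((z.1)%:E < tau z.2)%E%:R%:E)%E : \bar R).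
Proof.
move=> [f0 mf]; split=> [z|].
  by rewrite mule_ge0// lee_fin; case: (_ < _)%E.
apply: emeasurable_funM; first exact: measurableT_comp mf measurable_joint.
apply/measurable_EFinP.
apply: (measurableT_comp (f := fun b : bool => b%:R : R)) => //.
apply: (measurable_fun_bool true) => //.
rewrite setTI (_ : _ @^-1` _ = [set z : R * W | ((z.1)%:E < (tau z.2))%E]); last by [].
have m1 : measurable_fun [set: R * W] (fun z => (z.1)%:E : \bar R).
  by apply/measurable_EFinP; exact: measurable_fst.
have m2 : measurable_fun [set: R * W] (fun z => tau z.2).
  exact: measurableT_comp mtau measurable_snd.
rewrite -[X in measurable X]setTI.
exact: (measurable_lte measurableT m1 m2).
Qed.

Variable mu : probability (config d) R.

Definition killed_integral (t : R) (f : config d -> \bar R) : \bar R :=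
  (\int[path_law P mu]_(w in [set w | (t%:E < tau w)%E]) f (Xp (t, w)))%E.

Lemma posfun_killed t : posfun (killed_integral t).
Proof.
apply: (posfun_comp
  (fun g => \int[path_law P mu]_(w in [set w | (t%:E < tau w)%E]) g w)%E
  (fun w => Xp (t, w))).
  have t0 : 0 <= Num.max t 0 by rewrite le_max lexx orbT.
  exact: (mX _ t0).
exact: posfun_integral.
Qed.

Lemma measurable_killed_integral f : nnmeasurable f ->
  measurable_fun [set: R] (killed_integral ^~ f).
Proof.
move=> nf; have nk := measurable_killed_fun _ nf.
have := measurable_fun_fubini_tonelli_F (m2 := path_law P mu) _ nk.2 nk.1.
congr measurable_fun; apply/funext => t; rewrite /fubini_F /killed_integral.
rewrite [RHS]integral_mkcond; apply: eq_integral => w _.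
rewrite patchE; have [tw|tw] := pselect (t%:E < tau w)%E.
  by rewrite mem_set// tw mule1.
by rewrite memNset// (negbTE (introN idP tw)) mule0.
Qed.

Lemma killed_lawE t B : 0 <= t -> measurable B ->
  killed_law X P A mu t B = killed_integral t (fun x => (\1_B x)%:E).
Proof.
move=> t0 mB; rewrite /killed_integral /killed_law.
have mXB : measurable (X t @^-1` B).
  by rewrite -[X in measurable X]setTI; exact: mX.
transitivity (path_law P mu (X t @^-1` B `&` [set w | (t%:E < tau w)%E])).
  by [].
rewrite -integral_indic//; apply: eq_integral => w _.
by rewrite /Xp/= (max_idPl t0).
Qed.

Lemma Emu_path_law (f : W -> \bar R) : nnmeasurable f ->
  Emu P mu f = (\int[path_law P mu]_w f w)%E.
Proof. by move=> nf; rewrite integral_path_law. Qed.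

Lemma survivalE t : survival X P A mu t = path_law P mu [set w | (t%:E < tau w)%E].
Proof. by []. Qed.

Lemma tau_momentE k : tau_moment X P A mu k.+1 =
  (\int[leb]_(s in `[0%R, +oo[)
     ((k.+1%:R * s ^+ k)%:E * survival X P A mu s))%E.
Proof.
have nt : nnmeasurable tau by split=> // w; exact: tau_ge0.
have n1 : nnmeasurable (cst 1%E : W -> \bar R) by split.
rewrite /tau_moment Emu_path_law; last first.
  split=> [w|]; first exact: expe_ge0 (tau_ge0 _ _ _ _).
  elim: k => [|k IHk]; first exact: mtau.
  rewrite [X in measurable_fun _ X](_ : _ = fun w => (tau w * tau w ^+ k.+1)%E).
    exact: emeasurable_funM.
  by apply/funext => w; rewrite [LHS]expeS.
transitivity (\int[path_law P mu]_w (1 * tau w ^+ k.+1))%E.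
  by apply: eq_integral => w _; rewrite mul1e.
rewrite (layer_cake (path_law P mu) (cst 1%E) tau k n1 nt).
apply: eq_integral => s _; congr (_ * _)%E.
rewrite survivalE -[X in path_law P mu X]setIT -integral_indic//.
apply: eq_integral => w _; rewrite mul1e indicE.
by have [sw|sw] := pselect (s%:E < tau w)%E;
  [rewrite mem_set// sw|rewrite memNset// (negbTE (introN idP sw))].
Qed.

Lemma Emu_tauE : Emu P mu tau =
  (\int[leb]_(s in `[0%R, +oo[) survival X P A mu s)%E.
Proof.
have -> : Emu P mu tau = tau_moment X P A mu 1 by [].
by rewrite tau_momentE; apply: eq_integral => s _; rewrite mulr1 mul1e.
Qed.

Section PhiExists.
Hypothesis Etau : (0 < Emu P mu tau < +oo)%E.
Let r := fine (Emu P mu tau).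

Let r_gt0 : 0 < r.
Proof. by apply: fine_gt0. Qed.

Let psi (B : set (config d)) : \bar R :=
  (r^-1%:E * \int[leb]_(t in `[0%R, +oo[) killed_law X P A mu t B)%E.

Let measurable_killed_law (B : set (config d)) : measurable B ->
  measurable_fun (`[0%R, +oo[%classic : set R) (fun t => killed_law X P A mu t B).
Proof.
move=> mB; apply: (eq_measurable_fun (killed_integral ^~ (fun x => (\1_B x)%:E))).
  by move=> t; rewrite inE/= in_itv/= andbT => t0; rewrite killed_lawE.
by apply: measurable_funTS; apply: measurable_killed_integral; exact: nnmeasurable_indic.
Qed.

Let psi0 : psi set0 = 0%E.
Proof.
rewrite /psi integral0_eq ?mule0// => t _.
rewrite /killed_law (_ : [set w | _] = set0) ?measure0//.
by apply/seteqP; split=> // w [].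
Qed.

Let psi_ge0 B : (0 <= psi B)%E.
Proof.
by rewrite mule_ge0 ?lee_fin ?invr_ge0 ?(ltW r_gt0)//; apply: integral_ge0.
Qed.

Let psi_sigma_additive : semi_sigma_additive psi.
Proof.
move=> F mF tF mUF.
have -> : psi (\bigcup_n F n) =
    (r^-1%:E * \int[leb]_(t in `[0%R, +oo[)
       \sum_(n <oo) killed_law X P A mu t (F n))%E.
  congr (_ * _)%E; apply: eq_integral => t; rewrite inE/= in_itv/= andbT => t0.
  have -> : killed_law X P A mu t (\bigcup_n F n) =
      path_law P mu (\bigcup_n (X t @^-1` F n `&` [set w | (t%:E < tau w)%E])).
    rewrite -setI_bigcupl; congr (path_law P mu _).
  have mFt n : measurable (X t @^-1` F n `&` [set w | (t%:E < tau w)%E]).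
    by apply: measurableI => //; rewrite -[X in measurable X]setTI; exact: mX.
  apply/esym/cvg_lim => //; apply: measure_semi_sigma_additive => //.
    apply/trivIsetP => i j _ _ ij; apply/seteqP; split=> // w [[Fi _] [Fj _]].
    by have /trivIsetP/(_ i j I I ij) := tF => /seteqP[/(_ (X t w)) h _]; apply: h.
  exact: bigcupT_measurable.
apply/cvg_closeP; split.
  by apply: is_cvg_nneseries => n _ _; exact: psi_ge0.
rewrite closeE// integral_nneseries//; last by move=> n; exact: measurable_killed_law.
rewrite -nneseriesZl; last by move=> n _; apply: integral_ge0.
by [].
Qed.

HB.instance Definition _ := isMeasure.Build _ _ _ psi psi0 psi_ge0 psi_sigma_additive.

Let psiT : psi setT = 1%E.
Proof.
rewrite /psi.
have -> : (\int[leb]_(t in `[0%R, +oo[) killed_law X P A mu t setT = Emu P mu tau)%E.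
  rewrite Emu_tauE; apply: eq_integral => t _; congr (Pmu P mu _).
  by apply/seteqP; split=> w //= [].
have Efin : Emu P mu tau = r%:E.
  by rewrite /r fineK//; case/andP: Etau => h0 hy; rewrite ge0_fin_numE// ltW.
by rewrite Efin -EFinM mulVf// gt_eqF.
Qed.

HB.instance Definition _ := Measure_isProbability.Build _ _ _ psi psiT.

(** [Phi] is a choice with default value mu, so its formula holds only once some probability
    satisfies it. The candidate psi is a measure by exchanging sum and integral, and has mass 1 by
    [Emu_tauE]. *)
Lemma Phi_specP : Phi_spec X P A mu (Phi X P A mu).
Proof.
apply: (@xgetPex _ mu [set mu' | Phi_spec X P A mu mu']).
by exists (psi : probability (config d) R); split.
Qed.

(** [posfun_ext] carries the defining formula of [Phi] from sets to functions; it is wanted for f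
    the survival probability as a function of the starting point. *)
Lemma integral_Phi f : nnmeasurable f ->
  (r%:E * \int[Phi X P A mu]_x f x =
   \int[leb]_(t in `[0%R, +oo[) killed_integral t f)%E.
Proof.
have r0 : 0 <= r by exact: ltW.
move: f; apply: (posfun_ext (fun f => r%:E * \int[Phi X P A mu]_x f x)%E
  (fun f => \int[leb]_(t in `[0%R, +oo[) killed_integral t f)%E).
- have pI := posfun_integral (Phi X P A mu) setT measurableT.
  split.
  + by move=> f nf; rewrite mule_ge0 ?lee_fin// (posfun_ge0 _ pI).
  + move=> f g nf ng; rewrite (posfunD _ pI)// ge0_muleDr//; exact: (posfun_ge0 _ pI).
  + by move=> c f c0 nf; rewrite (posfunZ _ pI)// muleCA.
  + by move=> f g nf ng fg; rewrite lee_pmul2l// ?lte_fin// (posfun_le _ pI).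
  + move=> f nf ndf; rewrite (posfun_lim _ pI)// limeMl//.
    apply: ereal_nondecreasing_is_cvgn => m n mn; apply: (posfun_le _ pI) => // x.
    exact: ndf.
- apply: (posfun_mixture leb (`[0%R, +oo[%classic : set R) killed_integral) => //.
  + by move=> t _; exact: posfun_killed.
  + by move=> f nf; apply: measurable_funTS; exact: measurable_killed_integral.
- move=> B mB; have -> : (\int[Phi X P A mu]_x (\1_B x)%:E = Phi X P A mu B)%E.
    by rewrite integral_indic// setIT.
  rewrite (Phi_specP.2 B mB) muleA -EFinM.
  rewrite divff ?gt_eqF// mul1e; apply: eq_integral => t.
  by rewrite inE/= in_itv/= andbT => t0; rewrite killed_lawE.
Qed.

End PhiExists.

End KilledLaw.

Section Translation.
Context {R : realType}.
Local Notation leb := (@lebesgue_measure R).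

(** The pushforward of Lebesgue measure under a translation agrees with it on half-open intervals,
    which determine it. *)
Lemma integral_shift (g : R -> \bar R) (s : R) : (forall t, 0 <= g t)%E ->
  measurable_fun [set: R] g ->
  (\int[leb]_(t in `[0%R, +oo[) g (t + s)%R = \int[leb]_(t in `[s, +oo[) g t)%E.
Proof.
move=> g0 mg.
have ms : measurable_fun [set: R] (fun t : R => t + s : measurableTypeR R).
  exact: measurable_funD.
rewrite [RHS](eq_measure_integral
  (pushforward leb (fun t : R => t + s : measurableTypeR R))); last first.
  move=> B mB _; apply: lebesgue_measure_unique => //= _ [[a b]] _ <-.
  rewrite /pushforward.
  have -> : (fun t : R => t + s) @^-1` `]a, b] = `]a - s, b - s]%classic.
    by apply/seteqP; split=> t /=; rewrite !in_itv/= ltrBlDr lerBrDr.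
  rewrite !lebesgue_measure_itv/= !lte_fin ltrD2r.
  by case: ifP => // _; rewrite -!EFinB; congr EFin; ring.
rewrite ge0_integral_pushforward//.
- congr (integral _ _ _); apply/seteqP; split=> t /=; rewrite !in_itv/= !andbT.
    by rewrite lerDr.
  by rewrite lerDr.
- exact: measurable_funTS.
Qed.

End Translation.

Section PhiSurvival.
Context {R : realType} {d : nat}.
Context {dW : measure_display} {W : measurableType dW}.
Variables (p : site d -> site d -> R) (b : nat -> nat -> R).
Variables (X : R -> W -> config d) (P : R.-pker (config d) ~> W).
Variable S : set (config d).
Hypothesis hX : is_process p b X P S.
Hypothesis mS : measurable S.
Variables (L : {fset site d}) (k0 : int).
Local Notation A := (crowded L k0).
Local Notation tau := (tau X A).
Local Notation leb := (@lebesgue_measure R).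
Local Notation surv mu := (survival X P A mu).
Local Notation Phi := (Phi X P A).

Let mtau_gt t : measurable [set w | (t%:E < tau w)%E].
Proof. exact: (measurable_tau_gt _ _ _ _ _ hX). Qed.

Section Survival.
Variable mu : probability (config d) R.

Lemma survival_ge0 t : (0 <= surv mu t)%E.
Proof. by rewrite survivalE. Qed.

Lemma survival_le1 t : (surv mu t <= 1)%E.
Proof. by rewrite survivalE; exact: probability_le1. Qed.

Lemma survival_fin t : surv mu t = (fine (surv mu t))%:E.
Proof.
rewrite fineK// ge0_fin_numE ?survival_ge0//.
by rewrite (le_lt_trans (survival_le1 t))// ltry.
Qed.

Lemma survival_noninc s t : s <= t -> (surv mu t <= surv mu s)%E.
Proof.
move=> st; rewrite !survivalE; apply: le_measure; rewrite ?inE// => w /=.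
by apply: le_lt_trans; rewrite lee_fin.
Qed.

Lemma fine_survival01 t : 0 <= fine (surv mu t) <= 1.
Proof. by rewrite -!lee_fin -survival_fin survival_ge0 survival_le1. Qed.

Lemma fine_survival_noninc : nonincreasing_fun (fun t => fine (surv mu t)).
Proof. by move=> s t st; rewrite -lee_fin -!survival_fin survival_noninc. Qed.

Lemma measurable_survival : measurable_fun [set: R] (surv mu : R -> \bar R).
Proof.
rewrite (_ : (surv mu : R -> \bar R) = EFin \o (fun t => fine (surv mu t))).
  apply/measurable_EFinP; apply: nonincreasing_measurable => //.
  exact: fine_survival_noninc.
by apply/funext => t; rewrite /= -survival_fin.
Qed.

Hypothesis muS : mu (~` S) = 0%E.

Lemma ae_start : {ae mu, forall eta, S eta}.
Proof. by exists (~` S); split=> //; exact: measurableC. Qed.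

Hypothesis Etau : (0 < Emu P mu tau < +oo)%E.

(** The left side is the integral over t of the mean of [P (X t w) (tau > s)] on [tau > t]. For
    starting points in S, hence mu-almost everywhere, [markov_tau] turns it into the probability of
    [tau > t + s], and a shift of t concludes. *)
Lemma survival_Phi s : 0 <= s ->
  ((fine (Emu P mu tau))%:E * surv (Phi mu) s =
   \int[leb]_(t in `[s, +oo[) surv mu t)%E.
Proof.
move=> s0.
have nf : nnmeasurable (fun x => P x [set w | (s%:E < tau w)%E]).
  by split=> // ; exact: measurable_kernel.
rewrite (integral_Phi _ _ _ _ _ hX L k0 mu Etau _ nf).
rewrite -(integral_shift (surv mu) s survival_ge0 measurable_survival).
apply: eq_integral => t; rewrite inE/= in_itv/= andbT => t0.
rewrite /killed_integral integral_path_law//; last first.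
  have t0' : 0 <= Num.max t 0 by rewrite le_max lexx orbT.
  exact: (nnmeasurable_comp _ _ (proc_measurable hX t0') nf).
rewrite /survival /Pmu.
have mk u : measurable_fun [set: config d] (fun eta => P eta [set w | (u%:E < tau w)%E]).
  exact: measurable_kernel.
apply: ge0_ae_eq_integral => //.
- rewrite [X in measurable_fun _ X](_ : _ = fun eta => (\int[P eta]_w
      ((fun w => P (X (Num.max t 0%R) w) [set w0 | (s%:E < tau w0)%E]) \_
        [set w | (t%:E < tau w)%E]) w)%E); last first.
    by apply/funext => eta; rewrite integral_mkcond.
  apply: measurable_fun_integral_kernel => [U mU|w|].
  + exact: measurable_kernel.
  + by rewrite patchE; case: ifP.
  + apply/(measurable_restrictT _ _).1 => //; apply: measurable_funTS.
    apply: (measurable_kernel_comp _ _ _ _ _ hX) => //.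
    by rewrite le_max lexx orbT.
- by move=> eta _; exact: integral_ge0.
- apply: filterS ae_start => eta Seta _.
  rewrite (markov_tau _ _ _ _ _ hX L k0 eta t s Seta t0 s0).
  by apply: eq_integral => w _; rewrite /= (max_idPl t0).
Qed.

Lemma Phi_state : Phi mu (~` S) = 0%E.
Proof.
have [_ spec] := Phi_specP _ _ _ _ _ hX L k0 mu Etau.
rewrite spec; last exact: measurableC.
rewrite integral0_eq ?mule0// => t; rewrite /= in_itv/= andbT => t0.
rewrite /killed_law /Pmu; apply/eqP; rewrite eq_le; apply/andP; split; last first.
  exact: integral_ge0.
have mXS : measurable (X t @^-1` ~` S).
  rewrite -[X in measurable X]setTI; apply: (proc_measurable hX t0) => //.
  exact: measurableC.
rewrite -[leRHS](integral0 mu setT); apply: ae_ge0_le_integral => //.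
- by apply: measurable_kernel; exact: (measurableI _ _ mXS (mtau_gt t)).
- apply: filterS ae_start => eta Seta _.
  have [N [mN N0 HN]] := ae_state _ _ _ _ _ hX eta t Seta t0.
  rewrite -N0; apply: le_measure; rewrite ?inE//.
    exact: (measurableI _ _ mXS (mtau_gt t)).
  by move=> w [NS _]; apply: HN.
Qed.

End Survival.

(** No information on the mean of tau is required: where it is zero or infinite, [Phi] returns its
    argument. *)
Lemma iter_Phi_state (nu : probability (config d) R) n :
  nu (~` S) = 0%E -> iter n Phi nu (~` S) = 0%E.
Proof.
move=> nuS; elim: n => [//|n IHn] /=.
have [Etau|nEtau] := pselect (0 < Emu P (iter n Phi nu) tau < +oo)%E.
  exact: Phi_state.
suff -> : Phi (iter n Phi nu) = iter n Phi nu by [].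
by apply: xgetPN => mu' [/nEtau].
Qed.

End PhiSurvival.

(** * The invariant measure charges the state space *)

(** Turns an unordered sum over sites into a series, the form in which it can be exchanged with an
    integral and shown measurable. *)
Lemma esum_pickle {R : realType} {T : countType} (f : T -> \bar R) :
  (forall x, 0 <= f x)%E ->
  (\esum_(x in [set: T]) f x = \sum_(n <oo) oapp f 0%R (pickle_inv n))%E.
Proof.
move=> f0; have h0 n : (0 <= oapp f 0%R (pickle_inv n))%E.
  by case: (pickle_inv n) => //= x.
rewrite nneseries_esumT// (eq_esum (b := fun n : nat =>
    if n \in (@choice.pickle T @` setT) then oapp f 0%R (pickle_inv n) else 0%E)); last first.
  move=> n _; case: ifPn => //; rewrite notin_setE => /= H.
  case E : (pickle_inv n) => [x|]//=; exfalso; apply: H; exists x => //.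
  by have := pickle_invK (T := T) n; rewrite E.
rewrite -esum_mkcond (reindex_esum setT _ (@choice.pickle T)).
  by apply: eq_esum => x _; rewrite pickleK_inv.
by split=> // x y _ _; exact: (pcan_inj pickleK).
Qed.

Section SiteSums.
Context {R : realType} {d : nat}.

Lemma size_box (n : nat) (s : seq (site d)) : uniq s ->
  all (fun i => site_norm i <= n)%N s -> (size s <= (2 * n).+1 ^ d)%N.
Proof.
move=> us /allP sn.
pose phi (i : site d) : {ffun 'I_d -> 'I_(2 * n).+1} :=
  [ffun k => inord (absz (i ord0 k + n%:Z)%R)].
have phi_inj : {in s &, injective phi}.
  move=> i j /sn iN /sn jN /ffunP eij; apply/rowP => k.
  have := eij k; rewrite !ffunE => /(congr1 val) /=.
  have ik : (absz (i ord0 k) <= n)%N.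
    by apply: leq_trans iN; rewrite /site_norm (leq_bigmax k).
  have jk : (absz (j ord0 k) <= n)%N.
    by apply: leq_trans jN; rewrite /site_norm (leq_bigmax k).
  move: ik jk; move: (i ord0 k : int) (j ord0 k : int) => x y ik jk.
  by rewrite !inordK; lia.
rewrite -(size_map phi) -[X in (_ <= X ^ _)%N]card_ord -[X in (_ <= _ ^ X)%N]card_ord.
rewrite -card_ffun -(card_uniqP _) ?max_card//.
by rewrite map_inj_in_uniq.
Qed.

(** At most [(2 n + 1)^d <= exp (2 d n)] sites have norm n, so with this exponent they contribute at
    most [exp (- n)] together, and a geometric series remains. *)
Let a : R := (2 * d).+1%:R.

Lemma sum_site_exp_le (s : seq (site d)) : uniq s ->
  \sum_(i <- s) expR (- a * (site_norm i)%:R) <= (1 - expR (-1))^-1.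
Proof.
move=> us; pose N := (\max_(i <- s) site_norm i).+1.
have Ns i : i \in s -> (site_norm i < N)%N.
  by move=> si; rewrite ltnS; exact: leq_bigmax_seq.
have e1 : expR (-1) < 1 :> R by rewrite expR_lt1; lra.
have split_sum : \sum_(i <- s) expR (- a * (site_norm i)%:R) =
    \sum_(n < N) \sum_(i <- s | site_norm i == n) expR (- a * (site_norm i)%:R).
  rewrite (exchange_big_dep xpredT)//= big_seq [RHS]big_seq.
  apply: eq_bigr => i si.
  rewrite (bigD1 (Ordinal (Ns i si)))//= big1 ?addr0// => n /andP[/eqP ni /eqP[]].
  by apply: val_inj; rewrite /= ni.
rewrite split_sum; apply: (@le_trans _ _ (\sum_(n < N) expR (-1) ^+ n)); last first.
  rewrite -[leRHS]mul1r ler_pdivlMr ?subr_gt0// mulrC.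
  have := subrX1 (expR (-1) : R) N.
  have : 0 <= expR (-1) ^+ N :> R by rewrite exprn_ge0// expR_ge0.
  lra.
apply: ler_sum => n _; rewrite -big_filter.
rewrite (eq_big_seq (fun _ => expR (- a * n%:R))); last first.
  by move=> i; rewrite mem_filter => /andP[/eqP -> _].
rewrite big_const_seq count_predT iter_addr addr0 -[leLHS]mulr_natl.
have sz : (size [seq i <- s | site_norm i == n] <= (2 * n).+1 ^ d)%N.
  apply: size_box; first exact: filter_uniq.
  by apply/allP => i; rewrite mem_filter => /andP[/eqP -> _].
apply: (@le_trans _ _ (expR (2 * n%:R) ^+ d * expR (- a * n%:R))).
  rewrite ler_wpM2r ?expR_ge0//.
  apply: (@le_trans _ _ ((2 * n).+1%:R ^+ d)); first by rewrite -natrX ler_nat.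
  apply: lerXn2r; rewrite ?nnegrE ?expR_ge0//.
  by apply: le_trans (expR_ge1Dx _); rewrite -natr1 natrM addrC.
have aE : a = 2 * d%:R + 1 by rewrite /a -natr1 natrM.
rewrite -!expRM_natl -expRD ler_expR aE; lra.
Qed.

Lemma esum_site_exp :
  (\esum_(i in [set: site d]) (expR (- a * (site_norm i)%:R))%:E < +oo)%E.
Proof.
apply: (@le_lt_trans _ _ ((1 - expR (-1))^-1)%:E); last exact: ltry.
apply: ge_ereal_sup => _ [F [finF _] <-].
rewrite fsbig_finite//= sumEFin lee_fin; apply: sum_site_exp_le.
exact: fset_uniq.
Qed.

End SiteSums.

Section StateSpace.
Local Open Scope ereal_scope.
Context {R : realType} {d : nat}.

Let wsum (a : R) (eta : config d) : \bar R :=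
  \esum_(i in [set: site d]) (expR (- a * (site_norm i)%:R) * (eta i)%:R)%:E.

Let term (a : R) (eta : config d) (n : nat) : \bar R :=
  oapp (fun i : site d => (expR (- a * (site_norm i)%:R) * (eta i)%:R)%:E) 0
    (pickle_inv n).

Let wsumE a eta : wsum a eta = \sum_(n <oo) term a eta n.
Proof.
by rewrite /wsum esum_pickle// => i; rewrite lee_fin mulr_ge0// expR_ge0.
Qed.

Let term_ge0 a eta n : 0 <= term a eta n.
Proof.
by rewrite /term; case: (pickle_inv n) => //= i; rewrite lee_fin mulr_ge0// expR_ge0.
Qed.

Let measurable_occupation (i : site d) :
  measurable_fun [set: config d] (fun eta : config d => (eta i)%:R : R).
Proof.
apply: (measurableT_comp (f := fun n : nat => n%:R : R)) => //.
exact: measurable_coord.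
Qed.

Let measurable_term a n : measurable_fun [set: config d] (fun eta => term a eta n).
Proof.
rewrite /term; case: (pickle_inv n) => [i|] /=; last exact: measurable_cst.
by apply/measurable_EFinP; apply: measurable_funM => //; exact: measurable_occupation.
Qed.

Let measurable_wsum a : measurable_fun [set: config d] (wsum a).
Proof.
rewrite (_ : wsum a = fun eta => \sum_(n <oo) term a eta n); last first.
  by apply/funext => eta; exact: wsumE.
by apply: ge0_emeasurable_sum => //.
Qed.

Let wsum_le a a' eta : (a <= a')%R -> wsum a' eta <= wsum a eta.
Proof.
move=> aa'; apply: le_esum => i _; rewrite lee_fin ler_wpM2r// ler_expR.
by rewrite !mulNr lerN2 ler_wpM2r.
Qed.

Lemma measurable_state_space (M : model R) :
  measurable (state_space M : set (config d)).
Proof.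
case: M => [b g|].
  (* The weighted sum decreases in the exponent, so a real exponent can be replaced by a larger
     integer and the union becomes countable. *)
  rewrite (_ : state_space _ = \bigcup_n [set eta : config d | wsum n.+1%:R eta < +oo]).
    apply: bigcupT_measurable => n; rewrite -[X in measurable X]setTI.
    by apply: emeasurable_fun_infty_o => //; exact: measurable_wsum.
  apply/seteqP; split=> eta /= => [[a a0 fin]|[n _ fin]]; last by exists n.+1%:R.
  exists (Num.truncn a) => //; apply: le_lt_trans fin; apply: wsum_le.
  exact/ltW/truncnS_gt.
rewrite (_ : state_space _ = \bigcap_n [set eta : config d |
    oapp (fun i : site d => (eta i <= 1)%N) true (pickle_inv n)]).
  apply: bigcapT_measurable => n; case: (pickle_inv n) => [i|] /=; last first.
    by rewrite (_ : [set eta | _] = setT)//; apply/seteqP; split.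
  have := measurable_coord i measurableT [set m : nat | (m <= 1)%N] I.
  by rewrite setTI.
apply/seteqP; split=> eta /= H.
  by move=> n _ /=; case: (pickle_inv n) => //= i; exact: H.
by move=> i; have := H (choice.pickle i) I; rewrite /= pickleK_inv.
Qed.

Variables (q : nat -> R) (nu : probability (config d) R).
Hypothesis hnu : product_law q nu.

Lemma product_law_coord (i : site d) n : nu [set eta : config d | eta i = n] = (q n)%:E.
Proof.
have := hnu [fset i]%fset (fun=> n); rewrite big_seq_fset1 => <-.
congr (nu _); apply/seteqP; split=> eta /= => [H j|]; last by apply; rewrite inE.
by rewrite inE => /eqP ->.
Qed.

Lemma integral_occupation_le (i : site d) (K : \bar R) :
  \sum_(0 <= n <oo) (n%:R * q n)%:E <= K ->
  \int[nu]_eta ((eta : config d) i)%:R%:E <= K.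
Proof.
apply: le_trans.
have mi n : measurable [set eta : config d | eta i = n].
  have := measurable_coord i measurableT [set n] I.
  by rewrite setTI.
have mi1 n : measurable_fun [set: config d]
    (fun eta : config d => (n%:R * \1_[set eta : config d | eta i = n] eta)%:E : \bar R).
  apply/measurable_EFinP/measurable_funM; first exact: measurable_cst.
  exact: measurable_indic.
have -> : \sum_(0 <= n <oo) (n%:R * q n)%:E = \int[nu]_eta
    \sum_(0 <= n <oo) (n%:R * \1_[set eta : config d | eta i = n] eta)%:E.
  rewrite integral_nneseries//.
  apply: eq_eseriesr => n _; rewrite EFinM -(product_law_coord i).
  rewrite -[X in nu X]setIT -integral_indic// -ge0_integralZl_EFin//.
  exact/measurable_EFinP/measurable_indic.
apply: ge0_le_integral => //.
- by apply/measurable_EFinP; exact: measurable_occupation.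
- by apply: ge0_emeasurable_sum.
- move=> eta _; apply: le_trans (nneseries_lim_ge (eta i).+1 _) => //.
  rewrite big_nat_recr//= indicE mem_set// mulr1 leeDr// sume_ge0// => n _.
Qed.

Lemma state_space_exclusion : (forall n, (1 < n)%N -> q n = 0%R) ->
  nu (~` (state_space (Exclusion : model R) : set (config d))) = 0.
Proof.
move=> q0; apply: measure_negligible.
  by apply: measurableC; exact: measurable_state_space.
apply: (@negligibleS _ _ _ _ (\bigcup_m \bigcup_n [set eta : config d |
    oapp (fun i : site d => eta i = n.+2) False (pickle_inv m)])).
  move=> eta /=; rewrite -existsNP => -[i]; move/negP; rewrite -ltnNge => ei.
  exists (choice.pickle i) => //; exists (eta i - 2)%N => //=.
  by rewrite pickleK_inv /=; lia.
apply: negligible_bigcup => m; apply: negligible_bigcup => n.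
case: (pickle_inv m) => [i|] /=; last first.
  by rewrite (_ : [set eta | _] = set0)//; exact: negligible_set0.
apply/negligibleP; last by have := product_law_coord i n.+2; rewrite q0.
have := measurable_coord i measurableT [set n.+2] I.
by rewrite setTI.
Qed.

(** Every site has mean occupation at most K, so the weighted sum with the exponent of
    [esum_site_exp] has finite expectation and is finite almost surely. *)
Lemma state_space_misanthrope b g : (forall n, 0 <= q n)%R ->
  \sum_(0 <= n <oo) (n%:R * q n)%:E < +oo ->
  nu (~` (state_space (Misanthrope b g : model R) : set (config d))) = 0.
Proof.
move=> q0 Kfin; pose K := fine (\sum_(0 <= n <oo) (n%:R * q n)%:E).
have KE : \sum_(0 <= n <oo) (n%:R * q n)%:E = K%:E.
  rewrite fineK// ge0_fin_numE//; apply: nneseries_ge0 => n _ _.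
  by rewrite lee_fin mulr_ge0.
have K0 : (0 <= K)%R.
  by rewrite -lee_fin -KE; apply: nneseries_ge0 => n _ _; rewrite lee_fin mulr_ge0.
pose a : R := (2 * d).+1%:R.
have int_fin : \int[nu]_eta wsum a eta < +oo.
  under eq_integral do rewrite wsumE.
  rewrite integral_nneseries//.
  apply: (@le_lt_trans _ _ (K%:E *
      \esum_(i in [set: site d]) (expR (- a * (site_norm i)%:R))%:E)).
    rewrite esum_pickle -?nneseriesZl//.
    + apply: lee_nneseries => [n _ _|n _]; first exact: integral_ge0.
      rewrite /term; case: (pickle_inv n) => [i|] /=; last by rewrite integral0 mule0.
      under eq_integral do rewrite EFinM.
      rewrite ge0_integralZl_EFin//; last first.
        by apply/measurable_EFinP; exact: measurable_occupation.
      rewrite muleC lee_wpmul2r// integral_occupation_le// KE//.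
    + by move=> n _; case: (pickle_inv n) => //= i; rewrite lee_fin expR_ge0.
  rewrite lte_mul_pinfty//; first exact: esum_site_exp.
apply: measure_negligible; first by apply: measurableC; exact: measurable_state_space.
have wsum0 eta : 0 <= wsum a eta by rewrite wsumE; exact: nneseries_ge0.
have : nu.-integrable setT (wsum a).
  apply/integrableP; split; first exact: measurable_wsum.
  by under eq_integral do rewrite gee0_abs//.
move/(integrable_ae measurableT) => [N [mN N0 HN]].
exists N; split=> // eta /= nS; apply: HN => /= /(_ I) fin; apply: nS.
by exists a; [rewrite ltr0n|rewrite -[X in X < _]/(wsum a eta) -ge0_fin_numE].
Qed.

End StateSpace.

Section InvariantMeasure.
Local Open Scope ereal_scope.
Context {R : realType} {d : nat}.

Lemma theta_weight0 (g : nat -> R) n : (0 < n)%N -> theta_weight g 0 n = 0%R.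
Proof. by move=> n0; rewrite /theta_weight expr0n gtn_eqF// mul0r. Qed.

Lemma theta_ge0 (g : nat -> R) (gam : R) n : (forall k, 0 <= g k)%R -> (0 <= gam)%R ->
  (0 <= theta g gam n)%R.
Proof.
move=> g0 gam0.
have w0 k : (0 <= theta_weight g gam k)%R.
  by rewrite /theta_weight divr_ge0 ?exprn_ge0// prodr_ge0.
rewrite /theta divr_ge0// fine_ge0//; apply: nneseries_ge0 => k _ _.
by rewrite lee_fin.
Qed.

Lemma nu_state_space (M : model R) (rho : R) (nu : probability (config d) R) :
  model_wf M -> product_law (marginal M rho) nu ->
  nu (~` (state_space M : set (config d))) = 0.
Proof.
case: M => [b g|] /= hM hnu; last first.
  by apply: (state_space_exclusion _ _ hnu) => -[|[|]].
have g0 := mis_g_ge0 hM.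
have fug : (0 <= fugacity g rho)%R /\ Upsilon g (fugacity g rho) < +oo.
  rewrite /fugacity; case: xgetP => [gam _ [[gam0 _] UE]|_].
    by split=> //; rewrite UE ltry.
  (* If no fugacity realises rho, [get] returns the default point 0, for which all weights of index
     at least 1 vanish and [Upsilon] is zero. *)
  have -> : (point : R) = 0%R by [].
  split=> //; rewrite /Upsilon eseries0 ?ltry// => n n0 _.
  by rewrite /theta theta_weight0// mul0r mulr0.
have q0 n : (0 <= theta g (fugacity g rho) n)%R by exact: theta_ge0 g0 fug.1.
apply: (state_space_misanthrope _ _ hnu b g q0).
rewrite (@nneseries_split _ _ 0 1)//; last first.
  by move=> k _; rewrite lee_fin mulr_ge0//; exact: q0.
by rewrite big_nat1 mul0r add0e; exact: fug.2.
Qed.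

End InvariantMeasure.

(** * Convergence *)

Section DecayRate.
Context {R : realType}.
Variables (u : R -> R) (lam : R).
Hypothesis u01 : forall t, 0 <= u t <= 1.
Hypothesis u_noninc : nonincreasing_fun u.
Hypothesis u_rate : (- ((t^-1)%:E * lne (u t)%:E))%E @[t --> +oo%R] --> lam%:E.

Lemma decay_rate_upper (kap : R) : 0 < kap -> kap < lam ->
  exists2 C : R, 0 < C & forall s : R, 0 <= s -> u s <= C * expR (- kap * s).
Proof.
move=> k0 kl.
have near_gt : \forall t \near +oo%R, (kap%:E < - ((t^-1)%:E * lne (u t)%:E))%E.
  have nb : nbhs lam%:E [set x | (kap%:E < x)%E] by apply: open_ereal_gt'; rewrite lte_fin.
  exact: u_rate _ nb.
have [T [_ HT]] : \forall t \near +oo%R,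
    0 < t /\ (kap%:E < - ((t^-1)%:E * lne (u t)%:E))%E.
  by apply: filterS2 (nbhs_pinfty_gt (num_real 0)) near_gt.
pose T' := Num.max T 0.
have T'0 : 0 <= T' by rewrite le_max lexx orbT.
have large t : T' < t -> u t <= expR (- kap * t).
  rewrite gt_max => /andP[/HT[t0 Ht] _]; move: Ht.
  have /andP[ut _] := u01 t.
  move: ut; rewrite le_eqVlt => /predU1P[<- _|ut]; first exact: expR_ge0.
  rewrite lne_EFin// -EFinM -EFinN lte_fin => Ht.
  rewrite -(lnK (x := u t)) ?posrE// ler_expR.
  move: Ht; rewrite -mulrN mulrC ltr_pdivlMr// => /ltW; lra.
(* Up to T' this constant makes the right-hand side at least 1, and [u <= 1] suffices. *)
exists (expR (kap * T')); first exact: expR_gt0.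
move=> s s0; rewrite -expRD; have [sT|Ts] := leP s T'.
  have /andP[_ us] := u01 s; apply: (le_trans us).
  rewrite -[leLHS]expR0 ler_expR.
  have : kap * s <= kap * T' by rewrite ler_pM2l.
  lra.
apply: (le_trans (large s Ts)); rewrite ler_expR.
have : 0 <= kap * T' by rewrite mulr_ge0// ltW.
lra.
Qed.

Lemma decay_rate_lower (kap : R) : 0 < kap -> lam < kap ->
  exists2 C : R, 0 < C & forall s : R, 0 <= s -> C * expR (- kap * s) <= u s.
Proof.
move=> k0 kl.
have near_lt : \forall t \near +oo%R, (- ((t^-1)%:E * lne (u t)%:E) < kap%:E)%E.
  have nb : nbhs lam%:E [set x | (x < kap%:E)%E] by apply: open_ereal_lt'; rewrite lte_fin.
  exact: u_rate _ nb.
have [T [_ HT]] : \forall t \near +oo%R,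
    0 < t /\ (- ((t^-1)%:E * lne (u t)%:E) < kap%:E)%E.
  by apply: filterS2 (nbhs_pinfty_gt (num_real 0)) near_lt.
pose T' := Num.max T 0 + 1.
have T'0 : 0 <= T' by rewrite addr_ge0// le_max lexx orbT.
have large t : T' <= t -> expR (- kap * t) <= u t.
  move=> Tt; have : Num.max T 0 < t by apply: lt_le_trans Tt; rewrite ltrDl.
  rewrite gt_max => /andP[/HT[t0 Ht] _]; move: Ht.
  have /andP[ut _] := u01 t.
  (* A zero of u at t would make the logarithmic rate there [+oo], against its being below kap. *)
  move: ut; rewrite le_eqVlt => /predU1P[<-|ut].
    by rewrite le0_lneNy// gt0_muleNy ?lte_fin ?invr_gt0// oppeK ltNge leey.
  rewrite lne_EFin// -EFinM -EFinN lte_fin => Ht.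
  rewrite -[leRHS](lnK (x := u t)) ?posrE// ler_expR.
  move: Ht; rewrite -mulrN mulrC ltr_pdivrMr// => /ltW; lra.
(* Before T' the bound comes from monotonicity: [u s] is at least [u T'], hence at least this
   constant. *)
exists (expR (- kap * T')); first exact: expR_gt0.
move=> s s0; have [Ts|sT] := leP T' s.
  apply: le_trans (large s Ts); rewrite ler_piMl ?expR_ge0//.
  by rewrite -expR0 ler_expR mulNr oppr_le0 mulr_ge0// ltW.
apply: (@le_trans _ _ (u T')); last exact/u_noninc/ltW.
apply: le_trans (large T' (lexx _)); rewrite ler_piMr ?expR_ge0//.
by rewrite -expR0 ler_expR mulNr oppr_le0 mulr_ge0// ltW.
Qed.

End DecayRate.

Theorem lemma2p3 (R : realType) (d : nat) (p : site d -> site d -> R)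
    (hp : jump_rates p) (M : model R) (hM : model_wf M)
    (dW : measure_display) (W : measurableType dW)
    (X : R -> W -> config d) (P : R.-pker (config d) ~> W)
    (hX : is_process p (model_rate M) X P (state_space M))
    (L : {fset site d}) (k0 : int)
    (rho : R) (hrho : density_range M rho)
    (nu : probability (config d) R) (hnu : product_law (marginal M rho) nu)
    (hA : (0 < nu (~` crowded L k0))%E)
    (lam : R) (hlam : is_decay_rate X P (crowded L k0) nu lam%:E)
    (lam_gt0 : 0 < lam) :
  (forall k : nat, (1 <= k)%N ->
     tau_moment X P (crowded L k0) (iter n (Phi X P (crowded L k0)) nu) k
       @[n --> \oo] --> (k`!%:R / lam ^+ k)%:E) /\
  (forall s : R, 0 <= s ->
     survival X P (crowded L k0) (iter n (Phi X P (crowded L k0)) nu) s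
       @[n --> \oo] --> (expR (- lam * s))%:E).
Proof.
have mS := @measurable_state_space R d M.
set A := crowded L k0.
pose mu n := iter n (Phi X P A) nu.
have muS n : mu n (~` state_space M) = 0%E.
  exact: iter_Phi_state hX mS L k0 nu n (nu_state_space _ _ _ hM hnu).
pose u n s := fine (survival X P A (mu n) s).
have uE n s : survival X P A (mu n) s = (u n s)%:E.
  exact: survival_fin hX L k0 (mu n) s.
have u01 n s : 0 <= u n s <= 1 by exact: fine_survival01 hX L k0 (mu n) s.
have u_noninc n : nonincreasing_fun (u n).
  exact: fine_survival_noninc hX L k0 (mu n).
have EtauE n : Emu P (mu n) (tau X A) =
    (\int[lebesgue_measure]_(t in `[0%R, +oo[) (u n t)%:E)%E.
  rewrite (Emu_tauE _ _ _ _ _ hX); apply: eq_integral => t _; exact: uE.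
have u_rel n : (0 < \int[lebesgue_measure]_(t in `[0%R, +oo[) (u n t)%:E < +oo)%E ->
    forall s, 0 <= s ->
    ((fine (\int[lebesgue_measure]_(t in `[0%R, +oo[) (u n t)%:E) * u n.+1 s)%:E =
     \int[lebesgue_measure]_(t in `[s, +oo[) (u n t)%:E)%E.
  rewrite -EtauE => Etau s s0; rewrite EFinM -uE.
  rewrite (survival_Phi _ _ _ _ _ hX mS L k0 (mu n) (muS n) Etau s s0).
  by apply: eq_integral => t _; exact: uE.
have u_rate : (- ((t^-1)%:E * lne (u 0%N t)%:E))%E @[t --> +oo%R] --> lam%:E.
  by under eq_fun do rewrite -uE; exact: hlam.
have upper := decay_rate_upper _ _ (u01 0%N) u_rate.
have lower kap : lam < kap -> exists2 C : R, 0 < C &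
    forall s : R, 0 <= s -> C * expR (- kap * s) <= u 0%N s.
  move=> kl; apply: (decay_rate_lower _ _ (u01 0%N) (u_noninc 0%N) u_rate) => //.
  exact: lt_trans kl.
split=> [[//|k] _|s s0].
  (* The factor [k + 1] of the layer cake formula completes the limit [k! / lam ^+ k.+1] of
     [moment_cvg] to [(k+1)! / lam ^+ k.+1]. *)
  have mE n : tau_moment X P A (mu n) k.+1 =
      (k.+1%:R%:E * \int[lebesgue_measure]_(s in `[0%R, +oo[) (s ^+ k * u n s)%:E)%E.
    rewrite (tau_momentE _ _ _ _ _ hX) -ge0_integralZl_EFin//; last first.
    - apply/measurable_EFinP/measurable_funM.
        by apply: measurable_funTS; exact: measurable_funX.
      by apply: measurable_funTS; apply: nonincreasing_measurable.
    - move=> s /=; rewrite in_itv/= andbT => s0; rewrite lee_fin mulr_ge0 ?exprn_ge0//.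
      by have /andP[] := u01 n s.
    by apply: eq_integral => s _; rewrite uE -!EFinM mulrA.
  rewrite [X in X @ _ --> _](_ : _ = fun n =>
    (k.+1%:R%:E * \int[lebesgue_measure]_(s in `[0%R, +oo[)
       (s ^+ k * u n s)%:E)%E); last first.
    by apply/funext => n; exact: mE.
  rewrite factS natrM -mulrA EFinM; apply: cvgeZl => //.
  exact: (moment_cvg u lam lam_gt0 u01 u_noninc u_rel upper lower k).
rewrite [X in X @ _ --> _](_ : _ = fun n => (u n s)%:E); last first.
  by apply/funext => n; exact: uE.
apply: cvg_EFin; first by near=> n.
exact: (iterate_cvg u lam lam_gt0 u01 u_noninc u_rel upper lower s s0).
Unshelve. all: by end_near. Qed.
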